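(* Let $\mathcal{H}=\mathcal{H}(X)$ be a reproducing kernel Hilbert space, let $A\in\mathscr{B}(\mathcal{H})$ and let $p,q\ge1$ be such that $\frac1p+\frac1q=1$. Then for $r\ge2$, $$ \mathrm{ber}^r(A)\le\left\|\frac{|A|^{\frac{pr}{2}}}{p}+\frac{|A^*|^{\frac{qr}{2}}}{q}\right\|_{\mathrm{ber}}-\min\left\{\frac1p,\frac1q\right\}\inf_{x\in X}\left(\langle|A|\hat k_x,\hat k_x\rangle^{\frac{pr}{4}}-\langle|A^*|\hat k_x,\hat k_x\rangle^{\frac{qr}{4}}\right)^2. $$
   Context: Reproducing kernel Hilbert space: $X$ is a non-empty set and $\mathcal{H}=\mathcal{H}(X)$ is a Hilbert space of complex-valued functions on $X$ such that for every $x\in X$ the evaluation $\phi\mapsto\phi(x)$ is continuous on $\mathcal{H}$. For $x\in X$, $k_x\in\mathcal{H}$ is the unique element with $\phi(x)=\langle\phi,k_x\rangle$ for all $\phi\in\mathcal{H}$, and $\hat k_x=k_x/\|k_x\|$ is the normalized reproducing kernel (so it is implicit that $k_x\neq 0$ for all $x\in X$). $\mathscr{B}(\mathcal{H})$ is the algebra of bounded linear operators on $\mathcal{H}$, and $|T|=(T^*T)^{1/2}$; powers of positive operators are defined by functional calculus. For $T\in\mathscr{B}(\mathcal{H})$, the Berezin number is $\mathrm{ber}(T)=\sup_{x\in X}|\langle T\hat k_x,\hat k_x\rangle|$ and the Berezin norm is $\|T\|_{\mathrm{ber}}=\sup_{x,y\in X}|\langle T\hat k_x,\hat k_y\rangle|$;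 $\mathrm{ber}^s(T)$ means $(\mathrm{ber}(T))^s$. *)

(* Defs.v *)
From HB Require Import structures.
From mathcomp Require Import all_boot all_order all_algebra.
From mathcomp Require Import sesquilinear complex.
From mathcomp Require Import all_classical all_reals all_analysis.

Set Implicit Arguments.
Unset Strict Implicit.
Unset Printing Implicit Defensive.

Import Order.TTheory GRing.Theory Num.Theory.
Import numFieldNormedType.Exports.

Local Open Scope classical_set_scope.
Local Open Scope ring_scope.
Local Open Scope complex_scope.

(* The inner product is linear in its first argument and conjugate-linear in
   the second one. *)
HB.mixin Record isHilbert (R : realType) H of CompleteNormedModule R[i] H := {
  inner : {dot H for @Num.conj R[i]};
  inner_normE : forall u : H, inner u u = `|u| ^+ 2 }.

#[short(type="hilbertType")]
HB.structure Definition Hilbert (R : realType) :=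
  { H of isHilbert R H & CompleteNormedModule R[i] H }.

(* A Hilbert space of functions X -> R[i] is given by a Hilbert space H together
   with the linear injection [rkhs_eval] sending an element of H to the function
   that it is. *)
HB.mixin Record isRKHS (R : realType) (X : Type) H of Hilbert R H := {
  rkhs_eval : {linear H -> (X -> R[i])};
  rkhs_eval_inj : injective rkhs_eval;
  rkhs_eval_continuous : forall x : X, continuous (fun phi : H => rkhs_eval phi x : R[i]^o) }.

#[short(type="rkhsType")]
HB.structure Definition RKHS (R : realType) (X : Type) :=
  { H of isRKHS R X H & Hilbert R H }.

Section Operators.
Context {R : realType} {H : hilbertType R}.
Implicit Types T S : H -> H.

Local Notation "<< u , v >>" := (inner u v).

(* For T bounded and linear, the set is a singleton by the Riesz theorem. *)
Definition adjoint T : H -> H :=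
  fun v => xget 0 [set w | forall u, << T u, v >> = << u, w >>].

Definition spectrum T : set R[i] :=
  [set l | ~ exists S : {linear H -> H}, continuous S /\
     (forall v, S (T v - l *: v) = v) /\ (forall v, T (S v) - l *: S v = v)].

Definition op_horner (P : {poly R}) T : H -> H :=
  \sum_(k < size P) (P`_k)%:C *: iter k T.

(* Convergence in operator norm. *)
Definition op_cvg (T_ : nat -> H -> H) T :=
  forall e : R, 0 < e ->
    \forall n \near \oo, forall v, `|T_ n v - T v| <= e%:C * `|v|.

(* Continuous functional calculus of a bounded self-adjoint T, whose spectrum is
   a compact subset of the real line: f(T) is the limit in operator norm of
   P_n(T), for real polynomials P_n converging to f uniformly on the spectrum.
   For f continuous on the spectrum such P_n exist (Weierstrass), and the limit
   exists and does not depend on their choice. *)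
Definition cfc (f : R -> R) T : H -> H :=
  xget 0 [set S | exists P_ : nat -> {poly R},
    {uniform [set t | spectrum T t%:C],
      (fun n t => (P_ n).[t]) @ \oo --> f} /\
    op_cvg (fun n => op_horner (P_ n) T) S].

Definition op_pow T (s : R) : H -> H := cfc (fun t => t `^ s) T.

Definition op_abs T : H -> H := op_pow (adjoint T \o T) 2^-1.

End Operators.

Section Berezin.
Context {R : realType} {X : Type} {H : rkhsType R X}.

(* For every x the set is a singleton by the Riesz theorem. *)
Definition rkernel (x : X) : H :=
  xget 0 [set k | forall phi : H, rkhs_eval phi x = inner phi k].

Definition nkernel (x : X) : H := `|rkernel x|^-1 *: rkernel x.

(* The suprema below are those of bounded sets of reals when T is bounded. *)
Definition ber (T : H -> H) : R :=
  sup (range (fun x : X => complex.Re `|inner (T (nkernel x)) (nkernel x)|)).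

Definition ber_norm (T : H -> H) : R :=
  sup (range (fun xy : X * X =>
    complex.Re `|inner (T (nkernel xy.1)) (nkernel xy.2)|)).

End Berezin.

(* Main.v *)
(* For a unit vector k, Kato's inequality |<A k, k>|^2 <= <|A| k, k> <|A^*| k, k>
   gives |<A k, k>|^r <= x^(r/2) y^(r/2) with x = <|A| k, k>, y = <|A^*| k, k>.
   Young's inequality with a quadratic remainder (Kittaneh-Manasrah) bounds this by
   x^(pr/2)/p + y^(qr/2)/q - min(1/p, 1/q) (x^(pr/4) - y^(qr/4))^2, and McCarthy's
   inequality x^s <= <|A|^s k, k>, s >= 1, turns the first two terms into the
   quadratic form of the operator whose Berezin norm appears.

   The functional calculus rests on one estimate: for T bounded self-adjoint on
   H <> 0 and P a real polynomial, |P| takes the value ||P(T)|| on the real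
   spectrum of T. Indeed P(T)^2 - ||P(T)||^2 is not bounded below, so neither is
   one of its linear factors T - z; such a z is real and lies in the spectrum. *)

Require Import Defs.
From HB Require Import structures.
From mathcomp Require Import all_boot all_order all_algebra.
From mathcomp Require Import sesquilinear complex.
From mathcomp Require Import all_classical all_reals all_analysis.
From mathcomp Require Import ring lra.

Set Implicit Arguments.
Unset Strict Implicit.
Unset Printing Implicit Defensive.

Import Order.TTheory GRing.Theory Num.Theory.
Import numFieldNormedType.Exports.

Local Open Scope classical_set_scope.
Local Open Scope ring_scope.
Local Open Scope complex_scope.

(** * The underlying real inner product *)

Section RealInner.
Context {R : realType} {H : hilbertType R}.
Implicit Types (u v w : H) (a b : R).

(** [adjoint] and [cfc] choose a point of a set by [xget], so nothing is known about them until that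
    set is shown nonempty and, for [cfc], its members are identified with a given limit.
    Completeness is used through one variational lemma, [lax_milgram]: it yields the Riesz vector
    behind [adjoint], the surjectivity that takes a real number out of the spectrum, and the
    solution of a regularised equation. The last one replaces the polar decomposition in Kato's
    inequality: |A| and |A^*| may be degenerate, |A| + e and |A^*| + e are not, and e tends to 0.
    The powers that occur have exponent 1/2 or at least 1, and uniform continuity on a bounded
    interval is proved for exactly these. Estimates are made for the real part of the inner product,
    a real symmetric form to which discriminants apply; complex statements are recovered by
    multiplying the first argument by i or by a phase. *)

Definition rip u v : R := complex.Re (inner u v).

Definition rnorm u : R := complex.Re `|u|.

Lemma innerDl u v w : inner (u + v) w = inner u w + inner v w.
Proof. exact: linearDl. Qed.
Lemma innerDr u v w : inner u (v + w) = inner u v + inner u w.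
Proof. exact: linearDr. Qed.
Lemma innerZl (a : R[i]) u v : inner (a *: u) v = a * inner u v.
Proof. exact: linearZl_LR. Qed.
Lemma innerZr (a : R[i]) u v : inner u (a *: v) = a^* * inner u v.
Proof. exact: linearZr_LR. Qed.
Lemma innerC u v : inner v u = (inner u v)^*.
Proof. by rewrite (hermC (inner (s:=H)) v u) expr0 mul1r. Qed.

Lemma rnormE u : `|u| = (rnorm u)%:C.
Proof. by rewrite RRe_real ?normr_real. Qed.
Lemma rnorm_ge0 u : 0 <= rnorm u.
Proof. by rewrite -ler0c -rnormE. Qed.
Lemma rnorm0 : rnorm 0 = 0.
Proof. by rewrite /rnorm normr0. Qed.
Lemma rnorm_eq0 u : rnorm u = 0 -> u = 0.
Proof. by move=> u0; apply/eqP; rewrite -normr_eq0 rnormE u0. Qed.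

Lemma ripE u : rip u u = rnorm u ^+ 2.
Proof. by rewrite /rip inner_normE rnormE -rmorphXn. Qed.
Lemma ripC u v : rip u v = rip v u.
Proof. by rewrite /rip innerC; case: (inner v u). Qed.
Lemma ripDl u v w : rip (u + v) w = rip u w + rip v w.
Proof. by rewrite /rip innerDl; case: (inner u w) (inner v w) => [? ?] []. Qed.
Lemma ripZl a u v : rip (a%:C *: u) v = a * rip u v.
Proof. by rewrite /rip innerZl; case: (inner u v) => x y /=; rewrite mul0r subr0. Qed.
Lemma ripDr u v w : rip u (v + w) = rip u v + rip u w.
Proof. by rewrite ripC ripDl !(ripC u). Qed.
Lemma ripZr a u v : rip u (a%:C *: v) = a * rip u v.
Proof. by rewrite ripC ripZl ripC. Qed.
Lemma ripNl u v : rip (- u) v = - rip u v.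
Proof. by have := ripZl (-1) u v; rewrite rmorphN1 scaleN1r mulN1r. Qed.
Lemma ripNr u v : rip u (- v) = - rip u v.
Proof. by rewrite ripC ripNl ripC. Qed.
Lemma rip0l u : rip 0 u = 0.
Proof. by have := ripZl 0 0 u; rewrite scaler0 mul0r. Qed.
Lemma rip0r u : rip u 0 = 0.
Proof. by rewrite ripC rip0l. Qed.

Definition rip_linE := (ripDl, ripDr, ripNl, ripNr, ripZl, ripZr).

Lemma rip_inj u v : (forall w, rip w u = rip w v) -> u = v.
Proof.
move=> h; apply/eqP; rewrite -subr_eq0; apply/eqP/rnorm_eq0/eqP.
by rewrite -sqrf_eq0 -ripE ripDr ripNr h subrr.
Qed.

Lemma ripi u v : rip ('i%C *: u) v = - complex.Im (inner u v).
Proof.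
by rewrite /rip innerZl; case: (inner u v) => x y /=; rewrite mul0r mul1r sub0r.
Qed.

(** Taking [c] to be 1 and then i recovers the real and the imaginary part. *)
Lemma rip_inner u v w z : (forall c : R[i], rip (c *: u) v = rip (c *: w) z) ->
  inner u v = inner w z.
Proof.
move=> h; have h1 := h 1; have := h 'i%C; rewrite !ripi => /oppr_inj h2.
move: h1; rewrite !scale1r /rip => h1; move: h1 h2.
by case: (inner u v) (inner w z) => [a b] [c d] /= -> ->.
Qed.

Lemma rnormZ (c : R[i]) u : rnorm (c *: u) = complex.Re `|c| * rnorm u.
Proof.
by rewrite /rnorm normrZ rnormE -[`|c|]RRe_real ?normr_real//= mul0r subr0.
Qed.
Lemma rnormZr a u : rnorm (a%:C *: u) = `|a| * rnorm u.
Proof. by rewrite rnormZ normc_def /= expr0n addr0 sqrtr_sqr. Qed.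
Lemma rnormN u : rnorm (- u) = rnorm u.
Proof. by rewrite /rnorm normrN. Qed.
Lemma ler_rnormD u v : rnorm (u + v) <= rnorm u + rnorm v.
Proof. by rewrite -lecR rmorphD /= -!rnormE ler_normD. Qed.
Lemma ler_rnormB u v : rnorm (u - v) <= rnorm u + rnorm v.
Proof. by rewrite -(rnormN v) ler_rnormD. Qed.

End RealInner.

(** * Completeness, Cauchy-Schwarz and minimisation of quadratic functionals *)

Section Hilbert.
Context {R : realType} {H : hilbertType R}.
Implicit Types (u v w : H) (a b c e : R) (T S : H -> H).

Lemma gt0_complexE (z : R[i]) : 0 < z -> exists2 e : R, 0 < e & z = e%:C.
Proof.
by case: z => x y; rewrite ltcE /= => /andP[/eqP -> x0]; exists x.
Qed.

Lemma natSinv_le e : 0 < e -> exists N, forall n, (N <= n)%N ->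
  n.+1%:R^-1 <= e.
Proof.
move=> e0; exists (Num.truncn e^-1) => n Nn; rewrite invf_ple ?posrE//; apply/ltW.
by apply: lt_le_trans (truncnS_gt _) _; rewrite ler_nat.
Qed.

(** The restriction to [e <= 1] lets second-order errors be absorbed into the linear term. *)
Lemma le_of_small_error a b c : 0 <= c ->
  (forall e, 0 < e <= 1 -> a <= b + c * e) -> a <= b.
Proof.
move=> c0 h; apply/ler_addgt0Pr => e e0.
have c1 : 0 < c + 1 by lra.
pose d := Num.min 1 (e / (c + 1)).
have d0 : 0 < d by rewrite lt_min ltr01 divr_gt0.
apply: (le_trans (h d _)); first by rewrite d0 ge_min lexx.
rewrite lerD2l (@le_trans _ _ ((c + 1) * d))//.
  by rewrite ler_wpM2r ?ltW//; lra.
by rewrite mulrC -ler_pdivlMr// ge_min lexx orbT.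
Qed.

Lemma hilbert_complete (u_ : nat -> H) :
  (forall e, 0 < e -> exists N, forall n m, (N <= n)%N -> (N <= m)%N ->
    rnorm (u_ n - u_ m) <= e) ->
  exists l, forall e, 0 < e -> exists N, forall n, (N <= n)%N ->
    rnorm (u_ n - l) <= e.
Proof.
move=> Cu; have ul : cvg (u_ @ \oo).
  apply: cauchy_cvg; apply: cauchy_exP => z /gt0_complexE[e e0 ->].
  have [|N hN] := Cu (e / 2); first by rewrite divr_gt0.
  exists (u_ N); exists N => // n /= Nn; rewrite -ball_normE /= rnormE ltcR.
  by apply: le_lt_trans (hN _ _ _ _) _ => //; lra.
exists (lim (u_ @ \oo)) => e e0.
have /cvgrPdist_le/(_ e%:C) := ul; rewrite ltcR => /(_ e0)[N _ hN].
by exists N => n Nn; rewrite -rnormN opprB -lecR -rnormE; exact: hN.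
Qed.

Lemma discriminant_le a b c : 0 <= c ->
  (forall t, 0 <= a + 2 * b * t + c * t ^+ 2) -> b ^+ 2 <= a * c.
Proof.
rewrite le_eqVlt => /predU1P[<- h|c0 h].
- have [->|b0] := eqVneq b 0; first by rewrite expr0n mulr0.
  (* At this point the affine function takes the value -1. *)
  have := h (- (a + 1) / (2 * b)).
  rewrite mul0r addr0 mulrCA mulfV ?mulf_neq0 ?pnatr_eq0//; lra.
- have := h (- b / c); rewrite expr_div_n sqrrN.
  have -> : a + 2 * b * (- b / c) + c * (b ^+ 2 / c ^+ 2) = (a * c - b ^+ 2) / c.
    by field; rewrite gt_eqF.
  by rewrite pmulr_lge0 ?invr_gt0// subr_ge0.
Qed.

Definition rbounded T := exists2 M, 0 <= M & forall v, rnorm (T v) <= M * rnorm v.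

Lemma rbounded_lincomb a b T S : rbounded T -> rbounded S ->
  rbounded (a%:C *: T + b%:C *: S).
Proof.
move=> [M M0 TM] [N N0 SN]; exists (`|a| * M + `|b| * N) => [|v].
  by rewrite addr_ge0 ?mulr_ge0.
apply: le_trans (ler_rnormD _ _) _; rewrite !rnormZr mulrDl -!mulrA.
by rewrite lerD// ler_wpM2l.
Qed.

Lemma rip_lincomb a b T S u v : rip ((a%:C *: T + b%:C *: S) u) v =
  a * rip (T u) v + b * rip (S u) v.
Proof. by rewrite ripDl !ripZl. Qed.

Definition rsym T := forall u v, rip (T u) v = rip u (T v).

Definition rpos T := forall v, 0 <= rip (T v) v.

Lemma linear_at0 T : linear T -> T 0 = 0.
Proof. by move=> lT; have := lT (-1) 0 0; rewrite scaler0 addr0 scaleN1r addNr. Qed.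

Lemma linear_atD T : linear T -> {morph T : u v / u + v}.
Proof. by move=> lT u v; have := lT 1 u v; rewrite !scale1r. Qed.

Lemma linear_atZ T : linear T -> scalable T.
Proof. by move=> lT a u; have := lT a u 0; rewrite (linear_at0 lT) !addr0. Qed.

Lemma linear_atN T : linear T -> {morph T : u / - u}.
Proof. by move=> lT u; rewrite -scaleN1r (linear_atZ lT) scaleN1r. Qed.

Lemma linear_atB T : linear T -> {morph T : u v / u - v}.
Proof. by move=> lT u v; rewrite (linear_atD lT) (linear_atN lT). Qed.

Lemma rsym_CauchySchwarz T u v : linear T -> rsym T -> rpos T ->
  rip (T u) v ^+ 2 <= rip (T u) u * rip (T v) v.
Proof.
move=> lT sT pT; apply: discriminant_le => // t.
have := pT (u + t%:C *: v); rewrite (linear_atD lT) (linear_atZ lT) !rip_linE.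
by rewrite (sT v u) (ripC v); lra.
Qed.

Lemma rip_sqr_le u v : rip u v ^+ 2 <= rnorm u ^+ 2 * rnorm v ^+ 2.
Proof.
rewrite -!ripE; apply: (rsym_CauchySchwarz (T := id)) => // w.
by rewrite ripE sqr_ge0.
Qed.

Lemma ler_rip u v : `|rip u v| <= rnorm u * rnorm v.
Proof.
rewrite -(@ler_pXn2r _ 2) ?nnegrE ?mulr_ge0 ?rnorm_ge0//.
by rewrite exprMn -normrX ger0_norm ?sqr_ge0// rip_sqr_le.
Qed.

Lemma ler_rip_op T M u v : (forall v, rnorm (T v) <= M * rnorm v) ->
  `|rip (T u) v| <= M * rnorm u * rnorm v.
Proof.
by move=> TM; apply: le_trans (ler_rip _ _) _; rewrite ler_wpM2r ?rnorm_ge0.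
Qed.

(* Minimises [v |-> <T v, v> - 2 f v]. *)
Lemma lax_milgram T c f : linear T -> rsym T -> rbounded T -> 0 < c ->
  (forall v, c * rnorm v ^+ 2 <= rip (T v) v) ->
  (forall a u v, f (a%:C *: u + v) = a * f u + f v) ->
  (exists K, forall v, `|f v| <= K * rnorm v) ->
  exists w, forall v, f v = rip v (T w).
Proof.
move=> lT sT [M M0 TM] c0 Tc lf [K fK].
have pT : rpos T.
  by move=> v; apply: le_trans (Tc v); rewrite mulr_ge0 ?sqr_ge0// ltW.
pose J v := rip (T v) v - 2 * f v.
have JD u h t : J (u + t%:C *: h) =
    J u + 2 * (rip (T u) h - f h) * t + rip (T h) h * t ^+ 2.
  rewrite /J (linear_atD lT) (linear_atZ lT) !rip_linE [u + _]addrC lf.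
  by rewrite (sT h u) (ripC h); ring.
(* [J v >= c n^2 - 2 K n] with [n = rnorm v]; complete the square in [n]. *)
have Jlb v : - (K ^+ 2 / c) <= J v.
  have := Tc v; have := fK v; rewrite ler_norml => /andP[_].
  rewrite /J; set n := rnorm v; set x := f v; set y := rip _ _ => xK cy.
  have : 0 <= (c * n - K) ^+ 2 / c by rewrite divr_ge0 ?sqr_ge0 ?ltW.
  have -> : (c * n - K) ^+ 2 / c = c * n ^+ 2 - 2 * (K * n) + K ^+ 2 / c.
    by field; rewrite gt_eqF.
  lra.
pose m := inf (range J).
have infJ : has_inf (range J).
  by split; [exists (J 0), 0|exists (- (K ^+ 2 / c)) => _ [v _ <-]].
have Jm v : m <= J v by apply: ge_inf; [exact: infJ.2|exists v].
have /choice[u_ Ju] (n : nat) : exists u, J u <= m + n.+1%:R^-1.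
  have [|_ [u _ <-] /ltW Ju] := @inf_adherent _ _ n.+1%:R^-1 _ infJ.
    by rewrite invr_gt0.
  by exists u.
clear infJ Jlb; clearbody m J.
(* [u_ n] minimises [J] up to [n.+1%:R^-1], so [t |-> J (u_ n + t h) - m] is a nonnegative quadratic
   with constant term at most that; its discriminant controls half the derivative of [J] at
   [u_ n]. *)
have uh n h : (rip (T (u_ n)) h - f h) ^+ 2 <= n.+1%:R^-1 * rip (T h) h.
  apply: discriminant_le => // t.
  have := Jm (u_ n + t%:C *: h); rewrite JD; have := Ju n.
  move: (J (u_ n)) n.+1%:R^-1 => x y; lra.
have [e e0|w uw] := hilbert_complete (u_ := u_).
  (* For [h = u_ i - u_ j] the two half-derivatives along [h] differ by [q = <T h, h>]. If their
     squares are at most [d q], then [q^2 <= 4 d q]; with [d = c e^2 / 4], coercivity gives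
     [rnorm h <= e]. *)
  have d0 : 0 < c * e ^+ 2 / 4 by rewrite divr_gt0// mulr_gt0// exprn_gt0.
  have [N invN] := natSinv_le d0; exists N => i j Ni Nj.
  set h := u_ i - u_ j; set q := rip (T h) h.
  have q0 : 0 <= q by exact: pT.
  have Eq : (rip (T (u_ i)) h - f h) - (rip (T (u_ j)) h - f h) = q.
    by rewrite /q {3}/h (linear_atB lT) !rip_linE; ring.
  have hi := le_trans (uh i h) (ler_wpM2r q0 (invN i Ni)).
  have hj := le_trans (uh j h) (ler_wpM2r q0 (invN j Nj)).
  have qq : q * q <= c * e ^+ 2 * q.
    move: Eq hi hj; move: (_ - f h) (_ - f h) q {q0} => x y q <- hi hj.
    by have := sqr_ge0 (x + y); lra.
  have qe : q <= c * e ^+ 2.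
    have [->|qn0] := eqVneq q 0; first by rewrite mulr_ge0 ?sqr_ge0 ?ltW.
    by rewrite -(ler_pM2r (_ : 0 < q))// lt_neqAle eq_sym qn0.
  rewrite -(@ler_pXn2r _ 2) ?nnegrE ?rnorm_ge0 ?(ltW e0)//.
  by rewrite -(ler_pM2l c0); exact: le_trans (Tc h) qe.
(* The half-derivative [x] at [w] vanishes: it is [y - z], with [y] the one at [u_ n] and [z] of the
   size of [u_ n - w], and [x^2 <= 2 y^2 + 2 z^2]. *)
exists w => v; rewrite ripC; apply/eqP; rewrite eq_sym -subr_eq0 -sqrf_eq0.
rewrite eq_le sqr_ge0 andbT; set x := _ - f v.
have q0 : 0 <= rip (T v) v by exact: pT.
apply: (@le_of_small_error _ _ (2 * (M * rnorm v) ^+ 2 + 2 * rip (T v) v)).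
  by have := sqr_ge0 (M * rnorm v); lra.
move=> e /andP[e0 e1]; have [N1 uw1] := uw e e0.
have [N2 invN] := natSinv_le e0; pose n := maxn N1 N2.
have := uh n v; set y := _ - f v => y2.
have {}y2 := le_trans y2 (ler_wpM2r q0 (invN n (leq_maxr _ _))).
have zM := ler_rip_op (u_ n - w) v TM.
set z := rip _ v in zM; have Ex : x = y - z.
  by rewrite /x /y /z (linear_atB lT) !rip_linE; ring.
have zM' : `|z| <= M * rnorm v * e.
  apply: le_trans zM _; rewrite mulrAC ler_wpM2l ?mulr_ge0 ?rnorm_ge0//.
  exact: uw1 (leq_maxl _ _).
have z2 : z ^+ 2 <= (M * rnorm v) ^+ 2 * e.
  rewrite -real_normK ?num_real//.
  apply: (@le_trans _ _ ((M * rnorm v * e) ^+ 2)).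
    by rewrite lerXn2r ?nnegrE// (le_trans _ zM').
  by rewrite exprMn ler_wpM2l ?sqr_ge0// expr2 ler_piMr// ltW.
by rewrite Ex add0r; have := sqr_ge0 (y + z); nra.
Qed.

End Hilbert.

(** * Adjoints, bounded inverses and points outside the spectrum *)

Section Spectrum.
Context {R : realType} {H : hilbertType R}.
Implicit Types (u v w : H) (a b c d e : R) (T S : H -> H).

(** The minimiser for the functional [rip ^~ y] solves the equation weakly, and [rip_inj] removes
    the test vector. *)
Lemma coercive_surj T c y : linear T -> rsym T -> rbounded T -> 0 < c ->
  (forall v, c * rnorm v ^+ 2 <= rip (T v) v) -> exists w, T w = y.
Proof.
move=> lT sT bT c0 Tc.
have [||w hw] := lax_milgram (f := fun v => rip v y) lT sT bT c0 Tc.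
- by move=> a u v; rewrite !rip_linE.
- by exists (rnorm y) => v; rewrite mulrC ler_rip.
by exists w; apply: rip_inj => v; rewrite hw.
Qed.

Lemma rsym_inner T : linear T -> rsym T ->
  forall u v, inner (T u) v = inner u (T v).
Proof.
by move=> lT sT u v; apply: rip_inner => a; rewrite -(linear_atZ lT) sT.
Qed.

(** The content is that [xget] does not fall back on 0: [lax_milgram] for the identity is the Riesz
    theorem for the real functional [rip (T u) v] of [u], and [rip_inner] makes the identity
    complex. *)
Lemma adjointE T : linear T -> rbounded T ->
  forall u v, inner (T u) v = inner u (adjoint T v).
Proof.
move=> lT [M M0 TM] u v; rewrite /adjoint; case: xgetP => [w _ /=|h]; first exact.
have [|||||||w hw] := @lax_milgram _ H id 1 (fun u => rip (T u) v).
- by [].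
- by [].
- by exists 1 => //= w; rewrite mul1r.
- by [].
- by move=> w; rewrite ripE mul1r.
- by move=> a w w'; rewrite lT !rip_linE.
- by exists (M * rnorm v) => w; rewrite mulrAC ler_rip_op.
case: (h w) => {}u /=; apply: rip_inner => a.
by rewrite -(linear_atZ lT) hw.
Qed.

Lemma adjoint_rip T : linear T -> rbounded T ->
  forall u v, rip (T u) v = rip u (adjoint T v).
Proof. by move=> lT bT u v; rewrite /rip adjointE. Qed.

Lemma adjoint_linear T : linear T -> rbounded T -> linear (adjoint T).
Proof.
move=> lT bT a u v; apply: rip_inj => w.
by rewrite /rip -adjointE// !innerDr !innerZr -!adjointE.
Qed.

Lemma rnorm_le_rip v c : 0 <= c -> rip v v <= c * rnorm v -> rnorm v <= c.
Proof.
move=> c0; rewrite ripE expr2; have [->//|v0] := eqVneq (rnorm v) 0.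
by rewrite ler_pM2r// lt_neqAle eq_sym v0 rnorm_ge0.
Qed.

Lemma adjoint_bounded T : linear T -> rbounded T -> rbounded (adjoint T).
Proof.
move=> lT bT; have [M M0 TM] := bT; exists M => // v.
apply: rnorm_le_rip; first by rewrite mulr_ge0 ?rnorm_ge0.
rewrite -adjoint_rip//; apply: le_trans (ler_norm _) _.
by rewrite mulrAC ler_rip_op.
Qed.

Lemma adjointK T : linear T -> rbounded T -> adjoint (adjoint T) = T.
Proof.
move=> lT bT; apply/funext => v; apply: rip_inj => w.
rewrite -adjoint_rip; [|exact: adjoint_linear|exact: adjoint_bounded].
by rewrite ripC -adjoint_rip// ripC.
Qed.

Lemma continuous_rbounded (T : {linear H -> H}) : continuous T -> rbounded T.
Proof.
move=> /(_ 0)/continuous_linear_bounded-/(_ 0)/linear_boundedP[z [zr hz]].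
have [M M0 zM] : exists2 M, 0 <= M & z < M%:C.
  exists (`|complex.Re z| + 1); first by rewrite addr_ge0.
  rewrite -[z]RRe_real// ltcR; have := ler_norm (complex.Re z); lra.
by exists M => // v; rewrite -lecR rmorphM /= -!rnormE hz.
Qed.

Lemma rbounded_continuous (T : {linear H -> H}) : rbounded T -> continuous T.
Proof.
move=> [M M0 TM]; apply/linear_bounded_continuous/linear_boundedP.
exists M%:C; split; first by rewrite complex_real eqxx.
move=> z Mz v; apply: (@le_trans _ _ (M%:C * `|v|)).
  by rewrite !rnormE -rmorphM lecR.
by rewrite ler_wpM2r// ltW.
Qed.

Lemma rnorm_bounded_inverse T c : linear T -> 0 < c ->
  (forall v, c * rnorm v <= rnorm (T v)) -> (forall y, exists v, T v = y) ->
  exists S : {linear H -> H},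
    continuous S /\ (forall v, S (T v) = v) /\ (forall v, T (S v) = v).
Proof.
move=> lT c0 Tc /choice[S TS].
have Tinj u v : T u = T v -> u = v.
  move=> uv; apply/eqP; rewrite -subr_eq0; apply/eqP/rnorm_eq0.
  apply/eqP; rewrite eq_le rnorm_ge0 andbT -(ler_pM2l c0) mulr0.
  by rewrite (le_trans (Tc _))// (linear_atB lT) uv subrr rnorm0.
have lS : linear S by move=> a u v; apply: Tinj; rewrite lT !TS.
pose SL := HB.pack_for {linear H -> H} S (GRing.isLinear.Build _ _ _ _ S lS).
exists SL; split; last by split => // v; apply: Tinj; rewrite TS.
apply: rbounded_continuous; exists c^-1; first by rewrite invr_ge0 ltW.
by move=> v; rewrite mulrC ler_pdivlMr// mulrC (le_trans (Tc _))//= TS.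
Qed.

Lemma linear_shift T (l : R[i]) : linear T -> linear (fun v => T v - l *: v).
Proof.
move=> lT a u v; rewrite lT scalerDr scalerBr !scalerA (mulrC l).
by rewrite opprD addrACA.
Qed.

Lemma not_spectrum T (l : R[i]) c : linear T -> 0 < c ->
  (forall v, c * rnorm v <= rnorm (T v - l *: v)) ->
  (forall y, exists v, T v - l *: v = y) -> ~ spectrum T l.
Proof.
move=> lT c0 Tc sT; apply.
by have [S] := rnorm_bounded_inverse (linear_shift l lT) c0 Tc sT; exists S.
Qed.

Lemma bounded_below_resolvent T (l : R[i]) : ~ spectrum T l ->
  exists2 c, 0 < c & forall v, c * rnorm v <= rnorm (T v - l *: v).
Proof.
move=> /contrapT[S [/continuous_rbounded[M M0 SM] [ST _]]].
(* Adding 1 keeps the constant meaningful when [M = 0], as on the zero space. *)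
exists (M + 1)^-1; first by rewrite invr_gt0; lra.
move=> v; rewrite mulrC ler_pdivrMr; last by lra.
rewrite -{1}(ST v) (le_trans (SM _))// mulrC ler_wpM2l ?rnorm_ge0//; lra.
Qed.

(** Symmetry makes [<T v, v>] real, so the imaginary part of [<T v - l v, v>] comes from [l] alone;
    Cauchy-Schwarz bounds it. *)
Lemma rsym_bounded_below_nonreal T (l : R[i]) v : linear T -> rsym T ->
  `|complex.Im l| * rnorm v <= rnorm (T v - l *: v).
Proof.
move=> lT sT; have [->|v0] := eqVneq (rnorm v) 0; first by rewrite mulr0 rnorm_ge0.
have {}v0 : 0 < rnorm v by rewrite lt_neqAle eq_sym v0 rnorm_ge0.
rewrite -(ler_pM2r v0); set w := T v - _.
have -> : `|complex.Im l| * rnorm v * rnorm v = `|rip ('i%C *: w) v|.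
  rewrite -mulrA -expr2 -[X in _ * X]ger0_norm ?sqr_ge0// -normrM; congr `|_|.
  rewrite ripi innerDl -scaleNr innerZl inner_normE rnormE -rmorphXn.
  have := innerC v (T v); rewrite -(rsym_inner lT sT).
  case: (inner (T v) v) => x y []; case: l {w} => a b /=; lra.
apply: le_trans (ler_rip _ _) _; rewrite rnormZ normc_def /=.
by rewrite expr0n expr1n add0r sqrtr1 mul1r.
Qed.

End Spectrum.

(** * Polynomials in an operator and the spectrum *)

Section PolynomialCalculus.
Context {R : realType} {H : hilbertType R}.
Implicit Types (u v w : H) (a b c d e : R) (T S : H -> H).

(** Complex coefficients are allowed because a real polynomial splits into linear factors only over
    [R[i]]. *)
Definition cop_horner (P : {poly R[i]}) T v : H :=
  \sum_(k < size P) P`_k *: iter k T v.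

Lemma cop_hornerE n (P : {poly R[i]}) T v : (size P <= n)%N ->
  cop_horner P T v = \sum_(k < n) P`_k *: iter k T v.
Proof.
move=> Pn; rewrite /cop_horner (big_ord_widen _ (fun k => P`_k *: iter k T v) Pn).
rewrite [RHS](bigID (fun k : 'I_n => (k < size P)%N)) /= [X in _ + X]big1 ?addr0//.
by move=> k; rewrite -leqNgt => /(nth_default 0) ->; rewrite scale0r.
Qed.

Lemma cop_hornerD (P Q : {poly R[i]}) T v :
  cop_horner (P + Q) T v = cop_horner P T v + cop_horner Q T v.
Proof.
rewrite (cop_hornerE _ _ (size_polyD P Q)).
rewrite (cop_hornerE _ _ (leq_maxl (size P) (size Q))).
rewrite (cop_hornerE _ _ (leq_maxr (size P) (size Q))) -big_split /=.
by apply: eq_bigr => k _; rewrite coefD scalerDl.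
Qed.

Lemma cop_hornerC (z : R[i]) T v : cop_horner z%:P T v = z *: v.
Proof.
by rewrite (cop_hornerE _ _ (size_polyC_leq1 z)) big_ord1 coefC.
Qed.

Lemma cop_hornerZ (z : R[i]) (P : {poly R[i]}) T v :
  cop_horner (z *: P) T v = z *: cop_horner P T v.
Proof.
rewrite (cop_hornerE _ _ (size_scale_leq z P)) scaler_sumr.
by apply: eq_bigr => k _; rewrite coefZ scalerA.
Qed.

Lemma cop_hornerMX (P : {poly R[i]}) T v : linear T ->
  cop_horner (P * 'X) T v = T (cop_horner P T v).
Proof.
move=> lT; rewrite (@cop_hornerE (size P).+1); last first.
  by have [->|P0] := eqVneq P 0; rewrite ?mul0r ?size_poly0// size_mulX.
rewrite big_ord_recl coefMX eqxx scale0r add0r /cop_horner.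
rewrite (big_morph T (linear_atD lT) (linear_at0 lT)).
by apply: eq_bigr => k _; rewrite coefMX (linear_atZ lT).
Qed.

Lemma cop_hornerX T v : linear T -> cop_horner 'X T v = T v.
Proof. by move=> lT; rewrite -['X]mul1r cop_hornerMX// cop_hornerC scale1r. Qed.

Lemma cop_hornerM (P Q : {poly R[i]}) T v : linear T ->
  cop_horner (P * Q) T v = cop_horner P T (cop_horner Q T v).
Proof.
move=> lT; elim/poly_ind: P v => [|P z IH] v.
  by rewrite mul0r -!polyC0 !cop_hornerC !scale0r.
rewrite mulrDl mulrAC !cop_hornerD !cop_hornerMX// IH mul_polyC.
by rewrite cop_hornerZ cop_hornerC.
Qed.

Lemma cop_horner_linear (P : {poly R[i]}) T : linear T -> linear (cop_horner P T).
Proof.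
move=> lT a u v; elim/poly_ind: P => [|P z IH].
  by rewrite -polyC0 !cop_hornerC !scale0r scaler0 addr0.
rewrite !cop_hornerD !cop_hornerMX// IH lT !cop_hornerC !scalerDr.
by rewrite !scalerA (mulrC z) addrACA.
Qed.

Lemma cop_horner_bounded (P : {poly R[i]}) T : linear T -> rbounded T ->
  rbounded (cop_horner P T).
Proof.
move=> lT [M M0 TM]; elim/poly_ind: P => [|P z [N N0 PN]].
  by exists 0 => // v; rewrite -polyC0 cop_hornerC scale0r rnorm0 mul0r.
exists (M * N + complex.Re `|z|).
  by rewrite addr_ge0 ?mulr_ge0// -ler0c RRe_real ?normr_real.
move=> v; rewrite cop_hornerD cop_hornerMX// cop_hornerC mulrDl.
rewrite (le_trans (ler_rnormD _ _))// lerD ?rnormZ//.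
by rewrite (le_trans (TM _))// -mulrA ler_wpM2l.
Qed.

Lemma op_hornerE (P : {poly R}) T v :
  op_horner P T v = cop_horner (map_poly (real_complex R) P) T v.
Proof.
rewrite /op_horner /cop_horner size_map_poly fct_sumE.
by apply: eq_bigr => k _; rewrite coef_map.
Qed.

Implicit Types P Q : {poly R}.

Lemma op_hornerD P Q T v :
  op_horner (P + Q) T v = op_horner P T v + op_horner Q T v.
Proof. by rewrite !op_hornerE rmorphD cop_hornerD. Qed.

Lemma op_hornerC c T v : op_horner c%:P T v = c%:C *: v.
Proof. by rewrite op_hornerE map_polyC cop_hornerC. Qed.

Lemma op_hornerN P T v : op_horner (- P) T v = - op_horner P T v.
Proof.
by rewrite !op_hornerE rmorphN -scaleN1r cop_hornerZ scaleN1r.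
Qed.

Lemma op_hornerB P Q T v :
  op_horner (P - Q) T v = op_horner P T v - op_horner Q T v.
Proof. by rewrite op_hornerD op_hornerN. Qed.

Lemma op_hornerX T v : linear T -> op_horner 'X T v = T v.
Proof. by move=> lT; rewrite op_hornerE map_polyX cop_hornerX. Qed.

Lemma op_hornerM P Q T v : linear T ->
  op_horner (P * Q) T v = op_horner P T (op_horner Q T v).
Proof. by move=> lT; rewrite !op_hornerE rmorphM cop_hornerM. Qed.

Lemma op_hornerMX P T v : linear T -> op_horner (P * 'X) T v = T (op_horner P T v).
Proof. by move=> lT; rewrite mulrC op_hornerM// op_hornerX. Qed.

Lemma op_horner_linear P T : linear T -> linear (op_horner P T).
Proof. by move=> lT a u v; rewrite !op_hornerE cop_horner_linear. Qed.

Lemma op_horner_bounded P T : linear T -> rbounded T -> rbounded (op_horner P T).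
Proof.
move=> lT bT; have [M M0 h] := cop_horner_bounded (map_poly (real_complex R) P) lT bT.
by exists M => // v; rewrite op_hornerE.
Qed.

Lemma op_horner_intertwine P (A : H -> H) S T v : linear A -> linear S -> linear T ->
  (forall v, A (T v) = S (A v)) -> A (op_horner P T v) = op_horner P S (A v).
Proof.
move=> lA lS lT AT; elim/poly_ind: P => [|P c IH].
  by rewrite -polyC0 !op_hornerC !scale0r (linear_at0 lA).
rewrite !op_hornerD !op_hornerMX// !op_hornerC (linear_atD lA) (linear_atZ lA).
by rewrite AT IH.
Qed.

Lemma op_horner_sym P T : linear T -> rsym T -> rsym (op_horner P T).
Proof.
move=> lT sT u v; elim/poly_ind: P u v => [|P c IH] u v.
  by rewrite -polyC0 !op_hornerC !scale0r rip0l rip0r.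
rewrite !op_hornerD !op_hornerMX// !op_hornerC !rip_linE sT IH.
by rewrite (@op_horner_intertwine P T T T).
Qed.

Lemma cop_horner_bounded_below (s : seq R[i]) T : linear T ->
  (forall z, z \in s -> exists2 c, 0 < c &
    forall v, c * rnorm v <= rnorm (T v - z *: v)) ->
  exists2 c, 0 < c & forall v,
    c * rnorm v <= rnorm (cop_horner (\prod_(z <- s) ('X - z%:P)) T v).
Proof.
move=> lT; elim: s => [|z s IH] sT.
  by exists 1 => // v; rewrite big_nil cop_hornerC scale1r mul1r.
have [|c c0 cs] := IH; first by move=> y ys; apply: sT; rewrite inE ys orbT.
have [d d0 dz] := sT z (mem_head _ _); exists (d * c); first exact: mulr_gt0.
move=> v; rewrite big_cons cop_hornerM// cop_hornerD cop_hornerX//.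
rewrite -scaleN1r cop_hornerZ cop_hornerC scaleN1r.
by rewrite (le_trans _ (dz _))// -mulrA ler_pM2l.
Qed.

(** [P] is factored over [R[i]]. A nonreal root gives a factor bounded below by symmetry; a real
    root lies outside the spectrum, so its factor has a bounded inverse. *)
Lemma spectral_root P T : linear T -> rsym T -> P != 0 ->
  (forall t, spectrum T t%:C -> P.[t] != 0) ->
  exists2 c, 0 < c & forall v, c * rnorm v <= rnorm (op_horner P T v).
Proof.
move=> lT sT P0 PT; pose Q := map_poly (real_complex R) P.
have Q0 : Q != 0 by rewrite map_poly_eq0.
have [s Es] := closed_field_poly_normal Q.
have [z zs|c c0 cs] := @cop_horner_bounded_below s T lT.
  have [z0|] := eqVneq (complex.Im z) 0; last first.
    rewrite -normr_gt0 => z0; exists `|complex.Im z| => // v.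
    exact: rsym_bounded_below_nonreal.
  apply: bounded_below_resolvent.
  have {z0} Ez : z = (complex.Re z)%:C by case: z z0 {zs} => a b /= ->.
  have : root Q z.
    by rewrite Es rootZ ?lead_coef_eq0// root_prod_XsubC.
  rewrite Ez => /eqP; rewrite horner_map => /complexI Pz Tz.
  by have := PT _ Tz; rewrite Pz eqxx.
pose l := complex.Re `|lead_coef Q|.
have l0 : 0 < l by rewrite -ltcR RRe_real ?normr_real// normr_gt0 lead_coef_eq0.
exists (l * c); first exact: mulr_gt0.
by move=> v; rewrite op_hornerE -/Q Es cop_hornerZ rnormZ -mulrA ler_pM2l.
Qed.

(* With [m] the operator norm of [P(T)], the operator [P(T)^2 - m^2] is not
   bounded below. *)
Lemma spectral_norm P T w : linear T -> rsym T -> rbounded T -> w != 0 ->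
  exists2 m, forall v, rnorm (op_horner P T v) <= m * rnorm v &
    P ^+ 2 != (m ^+ 2)%:P -> exists2 t, spectrum T t%:C & `|P.[t]| = m.
Proof.
move=> lT sT bT w0; pose B := op_horner P T.
have lB : linear B := op_horner_linear P lT.
have sB : rsym B := op_horner_sym P lT sT.
have [M M0 BM] := op_horner_bounded P lT bT.
pose D := [set rnorm (B v) | v in [set v | rnorm v <= 1]].
have supD : has_sup D.
  split; first by exists (rnorm (B 0)), 0 => //=; rewrite rnorm0.
  by exists M => _ [v /= v1 <-]; rewrite (le_trans (BM v))// ler_piMr.
pose m := sup D.
have m0 : 0 <= m.
  apply: le_trans (rnorm_ge0 (B 0)) _.
  by apply: (ub_le_sup supD.2); exists 0 => //=; rewrite rnorm0.
have Bm v : rnorm (B v) <= m * rnorm v.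
  have [/rnorm_eq0->|v0] := eqVneq (rnorm v) 0.
    by rewrite (linear_at0 lB) rnorm0 mulr0.
  have vp : 0 < rnorm v by rewrite lt_neqAle eq_sym v0 rnorm_ge0.
  rewrite -ler_pdivrMr// mulrC -[X in X * _]ger0_norm ?invr_ge0 ?(ltW vp)//.
  rewrite -rnormZr -(linear_atZ lB); apply: (ub_le_sup supD.2).
  exists ((rnorm v)^-1%:C *: v) => //=.
  by rewrite rnormZr ger0_norm ?invr_ge0 ?(ltW vp)// mulVf.
exists m => // Pm; apply: contrapT => noroot.
(* [Pm] makes this polynomial nonzero, as [spectral_root] asks. *)
have [|t Tt|d d0 Qd] := @spectral_root (P ^+ 2 - (m ^+ 2)%:P) T lT sT.
- by rewrite subr_eq0.
- apply/eqP; rewrite hornerD hornerN hornerC horner_exp => /eqP.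
  rewrite subr_eq0 -[P.[t] ^+ 2]real_normK ?num_real// eqrXn2// => /eqP Pt.
  by apply: noroot; exists t.
(* Expand [d^2 |v|^2 <= |B B v - m^2 v|^2] by symmetry of [B], and use [|B B v| <= m |B v|]. *)
have key v : m ^+ 2 * rnorm (B v) ^+ 2 <= (m ^+ 4 - d ^+ 2) * rnorm v ^+ 2.
  have := Qd v; rewrite op_hornerB expr2 op_hornerM// op_hornerC -/B.
  rewrite -(@ler_pXn2r _ 2) ?nnegrE ?rnorm_ge0 ?mulr_ge0 ?rnorm_ge0 ?(ltW d0)//.
  rewrite -[rnorm (_ - _) ^+ 2]ripE !rip_linE (sB (B v) v) (ripC v) (sB (B v) v).
  have : rnorm (B (B v)) ^+ 2 <= (m * rnorm (B v)) ^+ 2.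
    by rewrite lerXn2r ?nnegrE ?mulr_ge0 ?rnorm_ge0.
  rewrite !ripE; lra.
have wn : 0 < rnorm w.
  rewrite lt_neqAle rnorm_ge0 andbT eq_sym; apply/eqP => /rnorm_eq0 /eqP.
  by rewrite (negbTE w0).
have [mE|mn0] := eqVneq m 0.
  have := key w; rewrite mE !expr0n /= mul0r sub0r mulNr oppr_ge0 leNgt.
  by rewrite mulr_gt0// exprn_gt0.
have mp : 0 < m by rewrite lt_neqAle eq_sym mn0.
(* [key] divided by [m^2] bounds [|B v|^2] on the unit ball by a number below [m^2], against the
   choice of [m] as a supremum; the maximum with 0 allows the passage from [rnorm v <= 1] to the
   bound [k]. *)
pose k := Num.max 0 (m ^+ 2 - d ^+ 2 / m ^+ 2).
have km : Num.sqrt k < m.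
  rewrite -[ltRHS]ger0_norm// -sqrtr_sqr ltr_sqrt ?exprn_gt0// gt_max.
  by rewrite exprn_gt0//= gtrBl divr_gt0// exprn_gt0.
have : m <= Num.sqrt k.
  apply: ge_sup supD.1 _ => _ [v /= v1 <-].
  rewrite -[leLHS]ger0_norm ?rnorm_ge0// -sqrtr_sqr ler_wsqrtr//.
  apply: (@le_trans _ _ ((m ^+ 2 - d ^+ 2 / m ^+ 2) * rnorm v ^+ 2)).
    rewrite -(@ler_pM2l _ (m ^+ 2)) ?exprn_gt0//; apply: le_trans (key v) _.
    by rewrite [leRHS]mulrA (_ : m ^+ 2 * _ = m ^+ 4 - d ^+ 2)//; field.
  apply: (@le_trans _ _ (k * rnorm v ^+ 2)).
    by rewrite ler_wpM2r ?sqr_ge0// le_max lexx orbT.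
  by rewrite ler_piMr ?le_max ?lexx// expr_le1 ?rnorm_ge0.
by rewrite leNgt km.
Qed.

(** Either [|P|] attains the value [m] of [spectral_norm] on the spectrum, or [P ^+ 2] is the
    constant [m ^+ 2] and any point of the spectrum will do. *)
Lemma spectral_bound P T c : linear T -> rsym T -> rbounded T -> 0 <= c ->
  (forall t, spectrum T t%:C -> `|P.[t]| <= c) ->
  forall v, rnorm (op_horner P T v) <= c * rnorm v.
Proof.
move=> lT sT bT c0 Pc v.
have [->|v0] := eqVneq v 0.
  by rewrite (linear_at0 (op_horner_linear P lT)) !rnorm0 mulr0.
have [m Pm hm] := spectral_norm P lT sT bT v0.
rewrite (le_trans (Pm v))// ler_wpM2r ?rnorm_ge0//.
have [PE|/hm[t Tt <-]] := eqVneq (P ^+ 2) (m ^+ 2)%:P; last exact: Pc.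
(* The spectrum of an operator on a nonzero space is nonempty: ['X ^+ 2] is not constant, so
   [spectral_norm] for ['X] supplies a point. *)
have [k _ /(_ _)[|t Tt _]] := spectral_norm 'X lT sT bT v0.
  apply/eqP => /(congr1 (fun p : {poly R} => size p)).
  by rewrite size_polyXn => sz; have := size_polyC_leq1 (k ^+ 2); rewrite -sz.
have [m0|/ltW m0] := leP 0 m; last exact: le_trans m0 c0.
rewrite -[leLHS]ger0_norm// -(@ler_pXn2r _ 2) ?nnegrE// real_normK ?num_real//.
have := congr1 (horner^~ t) PE; rewrite hornerC horner_exp => <-.
by rewrite -[P.[t] ^+ 2]real_normK ?num_real// lerXn2r ?nnegrE// Pc.
Qed.

(* Shifting [P] by the midpoint of its range turns the norm bound into a lower
   bound for the quadratic form. *)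
Lemma spectral_lower_bound P T a b : linear T -> rsym T -> rbounded T ->
  (forall t, spectrum T t%:C -> a <= P.[t] <= b) ->
  forall v, a * rnorm v ^+ 2 <= rip (op_horner P T v) v.
Proof.
move=> lT sT bT Pab v.
(* The absolute value keeps [c] nonnegative when the spectrum is empty and nothing forces
   [a <= b]. *)
pose c := `|b - a| / 2; pose s := a + c.
have Ps t : spectrum T t%:C -> `|(P - s%:P).[t]| <= c.
  move=> /Pab /andP[aP Pb]; rewrite hornerD hornerN hornerC.
  have ab : `|b - a| = b - a by rewrite ger0_norm// subr_ge0 (le_trans aP).
  by rewrite ler_norml /s /c ab; lra.
have := @spectral_bound _ T c lT sT bT _ Ps v; rewrite divr_ge0// => /(_ isT) h.
have := le_trans (ler_rip (op_horner (P - s%:P) T v) v)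
  (ler_wpM2r (rnorm_ge0 v) h).
rewrite ler_norml op_hornerB op_hornerC !rip_linE ripE => /andP[+ _].
rewrite /s; lra.
Qed.

End PolynomialCalculus.

(** * Polynomial approximation of powers *)

Section Weierstrass.
Context {R : realType}.
Implicit Types (f g h : nat -> R) (x c d e s t M : R).

(* Bernstein's polynomial [\sum_(k <= n) 'C(n, k) g k x^k (1 - x)^(n - k)], by the
   recursion that conditions on the first of [n] independent trials. *)
Fixpoint bernstein n g : {poly R} :=
  if n is m.+1 then 'X * bernstein m (g \o S) + (1 - 'X) * bernstein m g
  else (g 0)%:P.

Lemma bernsteinS n g x : (bernstein n.+1 g).[x] =
  x * (bernstein n (g \o S)).[x] + (1 - x) * (bernstein n g).[x].
Proof. by rewrite /= hornerD !hornerM hornerD hornerN hornerX hornerC. Qed.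

Lemma bernsteinD n f g x : (bernstein n (fun k => f k + g k)).[x] =
  (bernstein n f).[x] + (bernstein n g).[x].
Proof.
elim: n f g => [|n IH] f g; first by rewrite /= !hornerC.
by rewrite !bernsteinS (IH (f \o S) (g \o S)) IH; ring.
Qed.

Lemma bernsteinZ n c g x : (bernstein n (fun k => c * g k)).[x] =
  c * (bernstein n g).[x].
Proof.
elim: n g => [|n IH] g; first by rewrite /= !hornerC.
by rewrite !bernsteinS (IH (g \o S)) IH; ring.
Qed.

Lemma bernstein_cst n c x : (bernstein n (fun=> c)).[x] = c.
Proof.
by elim: n => [|n IH]; rewrite ?bernsteinS ?/= ?hornerC// [X in X.[x]]/= IH; ring.
Qed.

(** Second moment of a binomial variable about [c]: squared bias plus variance. The induction needs
    an arbitrary [c], since a success in the first trial replaces [c] by [c - 1]. *)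
Lemma bernstein_variance n c x :
  (bernstein n (fun k => (k%:R - c) ^+ 2)).[x] =
  (n%:R * x - c) ^+ 2 + n%:R * x * (1 - x).
Proof.
elim: n c => [|n IH] c; first by rewrite /= hornerC !mul0r addr0.
rewrite bernsteinS IH.
have -> : (fun k => (k%:R - c) ^+ 2) \o S = (fun k => (k%:R - (c - 1)) ^+ 2).
  by apply/funext => k /=; rewrite -natr1; ring.
by rewrite IH -natr1; ring.
Qed.

Lemma bernstein_le n f g x : 0 <= x <= 1 -> (forall k, (k <= n)%N -> f k <= g k) ->
  (bernstein n f).[x] <= (bernstein n g).[x].
Proof.
move=> /andP[x0 x1]; elim: n f g => [|n IH] f g fg.
  by rewrite /= !hornerC fg.
rewrite !bernsteinS lerD// ler_wpM2l ?subr_ge0//; apply: IH => k kn; apply: fg => //.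
exact: leqW.
Qed.

(** Chebyshev's argument: the Bernstein operator is monotone and fixes constants, and the variance
    [n x (1 - x)] is at most [n]. *)
Lemma bernstein_dist n g a c e x : 0 <= x <= 1 ->
  0 <= c -> (forall k, (k <= n)%N -> `|g k - a| <= e + c * (k%:R - n%:R * x) ^+ 2) ->
  `|(bernstein n g).[x] - a| <= e + c * n%:R.
Proof.
move=> x01 c0 ga.
have var : e + c * (bernstein n (fun k => (k%:R - n%:R * x) ^+ 2)).[x] <= e + c * n%:R.
  rewrite bernstein_variance subrr expr0n add0r lerD2l ler_wpM2l//.
  case/andP: x01 => x0 x1; rewrite -mulrA ler_piMr//.
  by rewrite mulr_ile1// ?subr_ge0//; lra.
have Ue : (bernstein n (fun k => a + (e + c * (k%:R - n%:R * x) ^+ 2))).[x] =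
    a + (e + c * (bernstein n (fun k => (k%:R - n%:R * x) ^+ 2)).[x]).
  by rewrite !(bernsteinD, bernsteinZ, bernstein_cst).
have Le : (bernstein n (fun k => a + - 1 * (e + c * (k%:R - n%:R * x) ^+ 2))).[x] =
    a - (e + c * (bernstein n (fun k => (k%:R - n%:R * x) ^+ 2)).[x]).
  by rewrite bernsteinD bernsteinZ !(bernsteinD, bernsteinZ, bernstein_cst) mulN1r.
have U := @bernstein_le n g (fun k => a + (e + c * (k%:R - n%:R * x) ^+ 2)) x x01.
have L := @bernstein_le n (fun k => a + - 1 * (e + c * (k%:R - n%:R * x) ^+ 2)) g x x01.
rewrite Ue in U; rewrite Le in L.
rewrite ler_norml; apply/andP; split.
  rewrite lerBrDl; apply: le_trans (L _); first by rewrite lerD2l lerN2.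
  by move=> k kn; have := ga k kn; rewrite ler_norml => /andP[]; lra.
rewrite lerBlDl; apply: le_trans (U _) _; last by rewrite lerD2l.
by move=> k kn; have := ga k kn; rewrite ler_norml => /andP[]; lra.
Qed.

Lemma weierstrass (f : R -> R) M K : 0 < M ->
  (forall t, 0 <= t <= M -> `|f t| <= K) ->
  (forall e, 0 < e -> exists2 d, 0 < d & forall x y, 0 <= x <= M -> 0 <= y <= M ->
    `|x - y| <= d -> `|f x - f y| <= e) ->
  exists P_ : nat -> {poly R}, forall e, 0 < e -> exists N, forall n t, (N <= n)%N ->
    0 <= t <= M -> `|(P_ n).[t] - f t| <= e.
Proof.
move=> M0 fK fu.
pose P_ n := bernstein n.+1 (fun k => f (M * (k%:R / n.+1%:R))) \Po (M^-1 *: 'X).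
exists P_ => e e0; have e2 : 0 < e / 2 by rewrite divr_gt0.
have [d d0 fd] := fu _ e2.
have K0 : 0 <= K by apply: le_trans (fK 0 _); rewrite ?normr_ge0// lexx ltW.
have K2 : 0 <= 2 * K by rewrite mulr_ge0.
(* Within [d] of [t] uniform continuity gives the error [e / 2]; farther away the error is at most
   [2 K], hence at most [2 K ((y - t) / d)^2]. In the variable [k] of the sample point
   [y = M k / (n + 1)] this is [A / (n + 1)^2] times a squared deviation, so the variance
   contributes [A / (n + 1)]. *)
pose A := 2 * K * (M / d) ^+ 2.
have A0 : 0 <= A := mulr_ge0 K2 (sqr_ge0 _).
have eA : 0 < e / 2 / (A + 1) by rewrite divr_gt0//; lra.
have [N hN] := natSinv_le eA; exists N => n t Nn /andP[t0 tM].
rewrite horner_comp hornerZ hornerX mulrC.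
have x01 : 0 <= t / M <= 1 by rewrite divr_ge0 ?(ltW M0)//= ler_pdivrMr// mul1r.
have n0 : 0 < n.+1%:R :> R by [].
apply: (@le_trans _ _ (e / 2 + A / n.+1%:R ^+ 2 * n.+1%:R)); last first.
  rewrite (_ : A / _ * _ = A * n.+1%:R^-1); last by field; rewrite gt_eqF.
  rewrite [leRHS](splitr e) lerD2l; apply: le_trans (ler_wpM2l A0 (hN n Nn)) _.
  by rewrite mulrCA ler_piMr// ?(ltW e2)// ler_pdivrMr; lra.
apply: bernstein_dist => // [|k kn]; first by rewrite divr_ge0.
set y := M * _.
have y0M : 0 <= y <= M.
  rewrite mulr_ge0 ?divr_ge0 ?(ltW M0)//= ler_piMr ?(ltW M0)//.
  by rewrite ler_pdivrMr// mul1r ler_nat.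
have -> : A / n.+1%:R ^+ 2 * (k%:R - n.+1%:R * (t / M)) ^+ 2 =
    2 * K * ((y - t) / d) ^+ 2.
  by rewrite /A /y; field; rewrite ?gt_eqF.
have [yd|dy] := leP `|y - t| d.
  apply: le_trans (fd _ _ _ _ yd) _ => //; first by rewrite t0.
  by rewrite lerDl; exact: mulr_ge0 K2 (sqr_ge0 _).
apply: (@le_trans _ _ (2 * K)).
  have := ler_normB (f y) (f t); have := fK y y0M.
  by have := fK t; rewrite t0 tM => /(_ isT); lra.
apply: (@le_trans _ _ (2 * K * ((y - t) / d) ^+ 2)); last by rewrite lerDr ltW.
rewrite ler_peMr ?mulr_ge0// -real_normK ?num_real// expr_ge1//.
by rewrite normrM normfV [`|d|]gtr0_norm// ler_pdivlMr// mul1r ltW.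
Qed.

(** This is Young's inequality for [x] and [y ^ (s - 1)] with exponents [s] and [s / (s - 1)],
    multiplied by [s]; at [s = 1] the second exponent degenerates. *)
Lemma powR_tangent s x y : 1 <= s -> 0 <= x -> 0 <= y ->
  y `^ s + s * y `^ (s - 1) * (x - y) <= x `^ s.
Proof.
rewrite le_eqVlt => /predU1P[<- x0 y0|s1 x0 y0].
  by rewrite subrr powRr0 !powRr1//; lra.
have s0 : 0 < s by lra.
have s10 : 0 < s - 1 by lra.
have := @conjugate_powR R x (y `^ (s - 1)) s (s / (s - 1)) x0 (powR_ge0 _ _) s0.
rewrite divr_gt0// -powRrM => /(_ isT).
have -> : (s - 1) * (s / (s - 1)) = s by field; rewrite gt_eqF.
have -> : s^-1 + (s / (s - 1))^-1 = 1 by field; rewrite !gt_eqF.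
move=> /(_ erefl); rewrite -(ler_pM2l s0).
have -> : s * (x `^ s / s + y `^ s / (s / (s - 1))) = x `^ s + (s - 1) * y `^ s.
  by field; rewrite !gt_eqF.
by rewrite -(mulr_powRB1 y0 s0); lra.
Qed.

(** The square root has modulus [d = e^2]; for [s >= 1] the tangent at the larger point gives the
    Lipschitz constant [s M^(s - 1)]. *)
Lemma powR_unif_continuous s M : 0 <= M -> s = 2^-1 \/ 1 <= s ->
  forall e, 0 < e -> exists2 d, 0 < d & forall x y, 0 <= x <= M -> 0 <= y <= M ->
    `|x - y| <= d -> `|x `^ s - y `^ s| <= e.
Proof.
move=> M0 hs e e0.
suff [d d0 hd] : exists2 d, 0 < d & forall x y, 0 <= x <= M -> 0 <= y <= M ->
    x <= y -> y - x <= d -> y `^ s - x `^ s <= e.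
  exists d => // x y xM yM xyd; have s0 : 0 <= s by case: hs => [->|] //; lra.
  have [x0 y0] : 0 <= x /\ 0 <= y by case/andP: xM; case/andP: yM.
  have [xy|/ltW xy] := leP x y; move: xyd.
    rewrite distrC ger0_norm ?subr_ge0// => xyd.
    rewrite distrC ger0_norm; first exact: hd.
    by rewrite subr_ge0 ge0_ler_powR.
  rewrite ger0_norm ?subr_ge0// => xyd; rewrite ger0_norm; first exact: hd.
  by rewrite subr_ge0 ge0_ler_powR.
case: hs => [->|s1].
  exists (e ^+ 2); first by rewrite exprn_gt0.
  move=> x y /andP[x0 _] /andP[y0 _] xy yxe; rewrite !powR12_sqrt//.
  rewrite lerBlDl -(@ler_pXn2r _ 2) ?nnegrE ?addr_ge0 ?sqrtr_ge0 ?(ltW e0)//.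
  rewrite sqrrD !sqr_sqrtr//.
  have : 0 <= Num.sqrt x * e by rewrite mulr_ge0 ?sqrtr_ge0 ?(ltW e0).
  by lra.
have M1 : 0 < s * M `^ (s - 1) + 1.
  by have := mulr_ge0 (le_trans ler01 s1) (powR_ge0 M (s - 1)); lra.
exists (e / (s * M `^ (s - 1) + 1)); first by rewrite divr_gt0.
move=> x y /andP[x0 xM] /andP[y0 yM] xy; rewrite ler_pdivlMr// => yxe.
have T := powR_tangent s1 x0 y0.
apply: le_trans yxe.
apply: (@le_trans _ _ (s * y `^ (s - 1) * (y - x))); first by lra.
rewrite mulrC ler_wpM2l ?subr_ge0// (@le_trans _ _ (s * M `^ (s - 1)))//; last by lra.
by rewrite ler_wpM2l ?(le_trans ler01 s1)// ge0_ler_powR ?nnegrE// subr_ge0.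
Qed.

End Weierstrass.

(** * Powers of positive operators *)

Section PowerOfPositive.
Context {R : realType} {H : hilbertType R}.
Implicit Types (u v w : H) (a b c d e s t M : R) (T S : H -> H).
Implicit Types f : R -> R.

(** The sign [a] makes [a (T - t)] coercive, hence onto: it is 1 for [t] below the numerical range
    and -1 for [t] above it. *)
Lemma coercive_not_spectrum T a c t : linear T -> rsym T -> rbounded T ->
  0 < c -> `|a| = 1 ->
  (forall v, c * rnorm v ^+ 2 <= a * rip (T v - t%:C *: v) v) ->
  ~ spectrum T t%:C.
Proof.
move=> lT sT [M M0 TM] c0 a1 Tc.
pose B v := a%:C *: (T v - t%:C *: v).
have nB v : rnorm (B v) = rnorm (T v - t%:C *: v) by rewrite rnormZr a1 mul1r.
have lB : linear B.
  by move=> z u v; rewrite /B (linear_shift _ lT) scalerDr !scalerA (mulrC z).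
have sB : rsym B by move=> u v; rewrite /B !rip_linE sT.
have bB : rbounded B.
  exists (M + `|t|); first by rewrite addr_ge0.
  move=> v; rewrite nB mulrDl (le_trans (ler_rnormB _ _))// lerD//.
  by rewrite rnormZr.
have Bc v : c * rnorm v ^+ 2 <= rip (B v) v by rewrite ripZl Tc.
apply: (not_spectrum lT c0) => [v|y].
  have [->|v0] := eqVneq (rnorm v) 0; first by rewrite mulr0 rnorm_ge0.
  have {}v0 : 0 < rnorm v by rewrite lt_neqAle eq_sym v0 rnorm_ge0.
  rewrite -(ler_pM2r v0) -mulrA -expr2 -nB (le_trans (Bc v))//.
  by rewrite (le_trans (ler_norm _))// ler_rip.
have a0 : a%:C != 0 :> R[i].
  by rewrite (inj_eq (@complexI R) a 0) -normr_eq0 a1 oner_neq0.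
have [w Bw] := coercive_surj (a%:C *: y) lB sB bB c0 Bc.
by exists w; apply: (scalerI a0).
Qed.

Lemma spectrum_itv T M t : linear T -> rsym T -> rpos T -> 0 <= M ->
  (forall v, rnorm (T v) <= M * rnorm v) -> spectrum T t%:C -> 0 <= t <= M.
Proof.
move=> lT sT pT M0 TM Tt; have bT : rbounded T by exists M.
have [t0|t0] := leP 0 t; last first.
  exfalso; apply: (@coercive_not_spectrum T 1 (- t) t) Tt => //.
  - by rewrite oppr_gt0.
  - by rewrite normr1.
  - move=> v; rewrite !rip_linE ripE; have := pT v; lra.
have [//|Mt] := leP t M.
exfalso; apply: (@coercive_not_spectrum T (-1) (t - M) t) Tt => //.
- by rewrite subr_gt0.
- by rewrite normrN1.
- move=> v; rewrite !rip_linE ripE.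
  have := le_trans (ler_norm _) (ler_rip_op v v TM); rewrite expr2; lra.
Qed.

(** Approximation is asked on an interval and not on a spectrum, so that one sequence can serve two
    operators at once. *)
Definition approx_on f M (Q_ : nat -> {poly R}) :=
  forall e, 0 < e -> exists N, forall n t, (N <= n)%N ->
    0 <= t <= M -> `|(Q_ n).[t] - f t| <= e.

Definition rop_cvg (T_ : nat -> H -> H) S := forall e, 0 < e -> exists N,
  forall n v, (N <= n)%N -> rnorm (T_ n v - S v) <= e * rnorm v.

Lemma op_cvgE (T_ : nat -> H -> H) S : op_cvg T_ S <-> rop_cvg T_ S.
Proof.
split=> h e e0; have [N] := h e e0.
  move=> _ hN; exists N => n v Nn.
  by rewrite -lecR rmorphM /= -!rnormE; exact: hN.
by move=> hN; exists N => // n /= Nn v; rewrite !rnormE -rmorphM lecR hN.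
Qed.

Lemma uniform_cvgE (D : set R) f (P_ : nat -> {poly R}) :
  {uniform D, (fun n t => (P_ n).[t]) @ \oo --> f} <->
  (forall e, 0 < e -> exists N, forall n t, (N <= n)%N -> D t ->
     `|(P_ n).[t] - f t| <= e).
Proof.
split=> [h e e0|h V /uniform_nbhs[E []]].
  have [|N _ hN] := h [set g | forall t, D t -> ball (f t) e (g t)].
    apply/uniform_nbhs; exists [set xy | ball xy.1 e xy.2]; split => //.
    exact: entourage_ball (PosNum e0).
  exists N => n t Nn Dt; have := hN n Nn t Dt.
  by rewrite -ball_normE /= distrC => /ltW.
rewrite -entourage_ballE => -[e /= e0 eE] EV.
have [|N hN] := h (e / 2); first by rewrite divr_gt0.
exists N => // n /= Nn; apply: EV => t Dt; apply: eE => /=.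
rewrite -ball_normE /= distrC (le_lt_trans (hN n t Nn Dt))//; lra.
Qed.

End PowerOfPositive.

Section OpPow.
Context {R : realType} {H : hilbertType R}.
Implicit Types (u v w : H) (a b c d e s t M : R) (T S : H -> H) (f : R -> R).

Definition pos_op T := [/\ linear T, rsym T, rpos T & rbounded T].

Lemma pos_op_bound T : pos_op T ->
  exists2 M, 0 < M & forall v, rnorm (T v) <= M * rnorm v.
Proof.
move=> [_ _ _ [M M0 TM]]; exists (M + 1); first by lra.
by move=> v; rewrite (le_trans (TM v))// ler_wpM2r ?rnorm_ge0//; lra.
Qed.

Lemma rop_cvg_linear (T_ : nat -> H -> H) S : (forall n, linear (T_ n)) ->
  rop_cvg T_ S -> linear S.
Proof.
move=> lT TS a u v; apply/eqP; rewrite -subr_eq0; apply/eqP/rnorm_eq0/eqP.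
rewrite eq_le rnorm_ge0 andbT.
pose z := complex.Re `|a|.
have z0 : 0 <= z by rewrite -ler0c RRe_real ?normr_real.
apply: (@le_of_small_error _ _ _ (rnorm (a *: u + v) + (z * rnorm u + rnorm v))).
  by rewrite !addr_ge0 ?mulr_ge0 ?rnorm_ge0.
move=> e /andP[e0 _]; have [N hN] := TS e e0.
have Tn w := hN N w (leqnn N).
have -> : S (a *: u + v) - (a *: S u + S v) =
    a *: (T_ N u - S u) + (T_ N v - S v) - (T_ N (a *: u + v) - S (a *: u + v)).
  by rewrite lT scalerBr; apply: rip_inj => w; rewrite !rip_linE; ring.
rewrite add0r (le_trans (ler_rnormB _ _))// mulrDl addrC lerD//.
  by rewrite mulrC Tn.
rewrite (le_trans (ler_rnormD _ _))// mulrDl lerD//; last by rewrite mulrC Tn.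
by rewrite rnormZ -mulrA ler_wpM2l// mulrC Tn.
Qed.

Lemma rop_cvg_rip (T_ : nat -> H -> H) S u v : rop_cvg T_ S ->
  forall e, 0 < e -> exists N, forall n, (N <= n)%N ->
    `|rip (T_ n u) v - rip (S u) v| <= e.
Proof.
move=> TS e e0; have K1 : 0 < rnorm u * rnorm v + 1.
  by have := mulr_ge0 (rnorm_ge0 u) (rnorm_ge0 v); lra.
have [|N hN] := TS (e / (rnorm u * rnorm v + 1)); first exact: divr_gt0.
exists N => n Nn; rewrite -[- rip _ _]ripNl -ripDl (le_trans (ler_rip _ _))//.
apply: (le_trans (ler_wpM2r (rnorm_ge0 v) (hN n u Nn))).
by rewrite -[leLHS]mulrA [leLHS]mulrAC ler_pdivrMr// ler_wpM2l ?(ltW e0)//; lra.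
Qed.

Lemma rop_cvg_rsym (T_ : nat -> H -> H) S : (forall n, rsym (T_ n)) ->
  rop_cvg T_ S -> rsym S.
Proof.
move=> sT TS u v; apply/eqP; rewrite -subr_eq0 -normr_le0.
apply: (@le_of_small_error _ _ _ 2) => // e /andP[e0 _].
have [N1 h1] := rop_cvg_rip u v TS e0; have [N2 h2] := rop_cvg_rip v u TS e0.
have := h1 _ (leq_maxl N1 N2); have := h2 _ (leq_maxr N1 N2).
rewrite sT (ripC v) (ripC (S v)) !ler_norml; lra.
Qed.

Lemma rop_cvg_bounded (T_ : nat -> H -> H) S : (forall n, rbounded (T_ n)) ->
  rop_cvg T_ S -> rbounded S.
Proof.
move=> bT /(_ _ ltr01)[N hN]; have [M M0 TM] := bT N.
exists (M + 1) => [|v]; first by lra.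
have -> : S v = T_ N v - (T_ N v - S v) by rewrite opprB addrC subrK.
by rewrite (le_trans (ler_rnormB _ _))// mulrDl lerD// hN.
Qed.

(* Two uniform approximations of [f] on the spectrum yield the same operator, so
   the one picked by [cfc] is the limit along any approximation on [[0, M]]. *)
Lemma cfc_cvg T M f (Q_ : nat -> {poly R}) : pos_op T -> 0 < M ->
  (forall v, rnorm (T v) <= M * rnorm v) -> approx_on f M Q_ ->
  rop_cvg (fun n => op_horner (Q_ n) T) (cfc f T).
Proof.
move=> [lT sT pT bT] M0 TM Qf.
have specM t : spectrum T t%:C -> 0 <= t <= M.
  exact: spectrum_itv lT sT pT (ltW M0) TM.
(* [spectral_bound] for [P_ m - P'_ n]. With equal sequences this is the Cauchy property, with
   different ones the independence of the choice. *)
have dist (P_ P'_ : nat -> {poly R}) e :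
    (forall e, 0 < e -> exists N, forall n t, (N <= n)%N -> spectrum T t%:C ->
      `|(P_ n).[t] - f t| <= e) ->
    (forall e, 0 < e -> exists N, forall n t, (N <= n)%N -> spectrum T t%:C ->
      `|(P'_ n).[t] - f t| <= e) -> 0 < e ->
    exists N, forall m n v, (N <= m)%N -> (N <= n)%N ->
      rnorm (op_horner (P_ m) T v - op_horner (P'_ n) T v) <= e * rnorm v.
  move=> Pf P'f e0; have e2 : 0 < e / 2 by rewrite divr_gt0.
  have [N1 h1] := Pf _ e2; have [N2 h2] := P'f _ e2.
  exists (maxn N1 N2) => m n v; rewrite !geq_max => /andP[Nm _] /andP[_ Nn].
  rewrite -op_hornerB; apply: spectral_bound => //; first exact: ltW.
  move=> t Tt; rewrite hornerD hornerN.
  by have := h1 m t Nm Tt; have := h2 n t Nn Tt; rewrite !ler_norml; lra.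
have Qf' e : 0 < e -> exists N, forall n t, (N <= n)%N -> spectrum T t%:C ->
      `|(Q_ n).[t] - f t| <= e.
  by move=> /Qf[N hN]; exists N => n t Nn /specM; exact: hN.
have : exists S, rop_cvg (fun n => op_horner (Q_ n) T) S.
  have : forall v, exists l, forall e, 0 < e -> exists N, forall n, (N <= n)%N ->
      rnorm (op_horner (Q_ n) T v - l) <= e.
    move=> v; apply: hilbert_complete => e e0.
    have v1 : 0 < rnorm v + 1 by have := rnorm_ge0 v; lra.
    have [|N hN] := dist Q_ Q_ (e / (rnorm v + 1)) Qf' Qf'; first exact: divr_gt0.
    exists N => n m Nn Nm; rewrite (le_trans (hN n m v Nn Nm))//.
    by rewrite [leLHS]mulrAC ler_pdivrMr// ler_wpM2l ?(ltW e0)//; lra.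
  move=> /choice[S hS]; exists S => e e0.
  (* [N] does not depend on [v], so sending the second index to infinity turns the pointwise limit
     into a limit in operator norm. *)
  have [N hN] := dist Q_ Q_ e Qf' Qf' e0; exists N => n v Nn.
  apply/ler_addgt0Pr => d d0; have [N' hN'] := hS v d d0.
  have -> : op_horner (Q_ n) T v - S v =
      (op_horner (Q_ n) T v - op_horner (Q_ (maxn N N')) T v) +
      (op_horner (Q_ (maxn N N')) T v - S v) by rewrite addrA subrK.
  rewrite (le_trans (ler_rnormD _ _))// lerD//.
    by rewrite hN// leq_maxl.
  by rewrite hN'// leq_maxr.
move=> [S QS]; rewrite /cfc.
case: xgetP => [S' _ /= [P_ [/uniform_cvgE Pf /op_cvgE PS']]|].
  move=> e e0; have e2 : 0 < e / 2 by rewrite divr_gt0.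
  have [N1 h1] := dist Q_ P_ _ Qf' Pf e2; have [N2 h2] := PS' _ e2.
  exists N1 => n v Nn; set m := maxn N1 N2.
  have -> : op_horner (Q_ n) T v - S' v =
      (op_horner (Q_ n) T v - op_horner (P_ m) T v) +
      (op_horner (P_ m) T v - S' v) by rewrite addrA subrK.
  rewrite (le_trans (ler_rnormD _ _))// [e]splitr mulrDl lerD//.
    by rewrite h1// leq_maxl.
  by rewrite h2// leq_maxr.
(* The default value 0 of [xget] is excluded, since [S] belongs to the set. *)
move=> /(_ S)[]; exists Q_; split; last exact/op_cvgE.
exact/uniform_cvgE.
Qed.

Lemma powR_approx s M : 0 < M -> s = 2^-1 \/ 1 <= s ->
  exists Q_, approx_on (@powR R ^~ s) M Q_.
Proof.
move=> M0 hs; have s0 : 0 <= s by case: hs => [->|] //; lra.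
have [|Q_ hQ] := @weierstrass R (@powR R ^~ s) M (M `^ s) M0 _
  (powR_unif_continuous (ltW M0) hs); last by exists Q_.
move=> t /andP[t0 tM]; rewrite ger0_norm ?powR_ge0//.
by rewrite ge0_ler_powR ?nnegrE// ltW.
Qed.

(** Order preservation for a polynomial minorant [g]: on the spectrum [Q_ n - g] is at least [- e],
    and [K + e] is the upper bound that [spectral_lower_bound] also asks for. *)
Lemma rop_cvg_lower_bound T M f (g : {poly R}) (Q_ : nat -> {poly R}) S v :
  pos_op T -> 0 < M -> (forall v, rnorm (T v) <= M * rnorm v) ->
  approx_on f M Q_ -> rop_cvg (fun n => op_horner (Q_ n) T) S ->
  (exists K, forall t, 0 <= t <= M -> f t - g.[t] <= K) ->
  (forall t, 0 <= t -> g.[t] <= f t) ->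
  rip (op_horner g T v) v <= rip (S v) v.
Proof.
move=> [lT sT pT bT] M0 TM Qf QS [K fK] gf.
have n0 : 0 <= rnorm v ^+ 2 := sqr_ge0 _.
apply: (@le_of_small_error _ _ _ (rnorm v ^+ 2 + 1)); first by lra.
move=> e /andP[e0 _]; have [N1 h1] := Qf e e0.
have [N2 h2] := rop_cvg_rip v v QS e0; pose n := maxn N1 N2.
have := @spectral_lower_bound R H (Q_ n - g) T (- e) (K + e) lT sT bT _ v.
rewrite op_hornerB !rip_linE; have := h2 n (leq_maxr _ _); rewrite ler_norml.
move=> hh; have : - e * rnorm v ^+ 2 <=
      rip (op_horner (Q_ n) T v) v - rip (op_horner g T v) v ->
    rip (op_horner g T v) v <= rip (S v) v + (rnorm v ^+ 2 + 1) * e by lra.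
move=> imp /[dup] _ h; apply/imp/h => t Tt.
have tM := spectrum_itv lT sT pT (ltW M0) TM Tt.
have := h1 n t (leq_maxl _ _) tM; rewrite ler_norml hornerD hornerN.
have := fK t tM; case/andP: tM => t0 _; have := gf t t0; lra.
Qed.

Lemma op_pow_pos T s : pos_op T -> s = 2^-1 \/ 1 <= s -> pos_op (op_pow T s).
Proof.
move=> pT hs; have [lT sT _ bT] := pT; have [M M0 TM] := pos_op_bound pT.
have [Q_ Qf] := powR_approx M0 hs; have QS := cfc_cvg pT M0 TM Qf.
split.
- by apply: rop_cvg_linear QS => n; exact: op_horner_linear.
- by apply: rop_cvg_rsym QS => n; exact: op_horner_sym.
- move=> v; have := @rop_cvg_lower_bound T M _ 0 Q_ _ v pT M0 TM Qf QS.
  rewrite -(polyC0 R) op_hornerC scale0r rip0l; apply.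
    exists (M `^ s) => t /andP[t0 tM]; rewrite hornerC subr0.
    by rewrite ge0_ler_powR ?nnegrE ?(ltW M0)//; case: hs => [->|] //; lra.
  by move=> t t0; rewrite hornerC powR_ge0.
- by apply: rop_cvg_bounded QS => n; exact: op_horner_bounded.
Qed.

(** Jensen's argument: the minorant is the tangent [a + b t] of [t ^ s] at [y = <T v, v>], whose
    quadratic form at the unit vector [v] is [a + b y = y ^ s]. *)
Lemma mccarthy T s v : pos_op T -> 1 <= s -> rnorm v = 1 ->
  rip (T v) v `^ s <= rip (op_pow T s v) v.
Proof.
move=> pT s1 v1; have [lT sT rT bT] := pT; have [M M0 TM] := pos_op_bound pT.
have [Q_ Qf] := powR_approx M0 (or_intror s1); have QS := cfc_cvg pT M0 TM Qf.
set y := rip (T v) v; have y0 : 0 <= y := rT v.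
pose b := s * y `^ (s - 1); pose a := y `^ s - b * y.
have b0 : 0 <= b by rewrite mulr_ge0 ?powR_ge0//; lra.
have := @rop_cvg_lower_bound T M _ (a%:P + b%:P * 'X) Q_ _ v pT M0 TM Qf QS.
have ge t : (a%:P + b%:P * 'X).[t] = a + b * t.
  by rewrite hornerD hornerM hornerX !hornerC.
rewrite op_hornerD op_hornerMX// !op_hornerC (linear_atZ lT) !rip_linE ripE v1.
rewrite -/y expr1n mulr1 /a subrK; apply.
  exists (M `^ s - a) => t /andP[t0 tM]; rewrite ge.
  have : t `^ s <= M `^ s by rewrite ge0_ler_powR ?nnegrE ?(ltW M0)//; lra.
  have := mulr_ge0 b0 t0; lra.
by move=> t t0; rewrite ge; have := powR_tangent s1 t0 y0; rewrite /a /b; lra.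
Qed.

(** If [q] is within [e <= 1] of the square root of [t], then [q^2 - t] is at most
    [(2 sqrt M + 1) e] in absolute value, so [spectral_bound] puts [Q_ n (T)] squared close to
    [T]. *)
Lemma op_pow_half_sqr T v : pos_op T -> op_pow T 2^-1 (op_pow T 2^-1 v) = T v.
Proof.
move=> pT; have [lT sT rT bT] := pT; have [M M0 TM] := pos_op_bound pT.
have [Q_ Qf] := powR_approx M0 (or_introl (erefl _)); have QS := cfc_cvg pT M0 TM Qf.
rewrite -/(op_pow T 2^-1) in QS; set S := op_pow T 2^-1 in QS *.
have [lS _ _ [K K0 SK]] := op_pow_pos pT (or_introl (erefl _)).
rewrite -/S in lS SK.
apply/eqP; rewrite -subr_eq0; apply/eqP/rnorm_eq0/eqP; rewrite eq_le rnorm_ge0 andbT.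
have n0 := rnorm_ge0 v.
have sM0 : 0 <= Num.sqrt M := sqrtr_ge0 M.
(* The three terms bound [(Q - S) (Q v)], [S (Q v - S v)] and [Q (Q v) - T v], each divided by
   [e]. *)
apply: (@le_of_small_error _ _ _
  ((K + 1) * rnorm v + K * rnorm v + (2 * Num.sqrt M + 1) * rnorm v)).
  by rewrite !addr_ge0 ?mulr_ge0 ?addr_ge0 ?mulr_ge0.
move=> e /andP[e0 e1]; have [N1 h1] := Qf e e0; have [N2 h2] := QS e e0.
pose n := maxn N1 N2; pose Q := op_horner (Q_ n) T.
have lQ : linear Q := op_horner_linear (Q_ n) lT.
have QSn w : rnorm (Q w - S w) <= e * rnorm w by rewrite h2// leq_maxr.
have QQ : rnorm (Q (Q v) - T v) <= (2 * Num.sqrt M + 1) * e * rnorm v.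
  rewrite -[T v]op_hornerX// /Q -op_hornerM// -op_hornerB.
  apply: spectral_bound => //; first by rewrite mulr_ge0 ?(ltW e0)//; lra.
  move=> t /(spectrum_itv lT sT rT (ltW M0) TM) tM.
  have := h1 n t (leq_maxl _ _) tM; case/andP: tM => t0 tM.
  rewrite powR12_sqrt// hornerD hornerN hornerM hornerX.
  move: (Q_ n).[t] => q; rewrite -{2}(sqr_sqrtr t0) => qt.
  have -> : q * q - Num.sqrt t ^+ 2 =
      (q - Num.sqrt t + 2 * Num.sqrt t) * (q - Num.sqrt t).
    by ring.
  rewrite normrM ler_pM// (le_trans (ler_normD _ _))// addrC lerD//;
    last exact: le_trans qt e1.
  by rewrite ger0_norm ?mulr_ge0 ?sqrtr_ge0// ler_wpM2l// ler_wsqrtr.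
have Qv : rnorm (Q v) <= (K + 1) * rnorm v.
  have -> : Q v = S v + (Q v - S v) by rewrite addrC subrK.
  rewrite (le_trans (ler_rnormD _ _))// mulrDl lerD// (le_trans (QSn v))//.
  by rewrite ler_wpM2r.
have -> : S (S v) - T v = (Q (Q v) - T v) - (Q (Q v) - S (Q v)) - S (Q v - S v).
  by rewrite (linear_atB lS); apply: rip_inj => w; rewrite !rip_linE; ring.
rewrite add0r (le_trans (ler_rnormB _ _))//.
have A1 := le_trans (SK (Q v - S v)) (ler_wpM2l K0 (QSn v)).
have A2 := le_trans (QSn (Q v)) (ler_wpM2l (ltW e0) Qv).
have A3 := ler_rnormB (Q (Q v) - T v) (Q (Q v) - S (Q v)).
lra.
Qed.

End OpPow.

(** * Kato's inequality *)

Section Kato.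
Context {R : realType} {H : hilbertType R}.
Implicit Types (u v w : H) (a b c d e s t M : R) (T S : H -> H).

(** Rotating one argument by a phase reduces moduli of complex inner products to [rip]. *)
Lemma norm_inner_phase u v : exists2 c : R[i], complex.Re `|c| = 1 &
  complex.Re `|inner u v| = rip (c *: u) v.
Proof.
have [z0|z0] := eqVneq (inner u v) 0.
  by exists 1; rewrite ?normr1// /rip scale1r z0 normr0.
exists (`|inner u v| / inner u v); last by rewrite /rip innerZl divfK.
by rewrite normrM normfV normr_id divff// normr_eq0.
Qed.

Lemma ler_norm_inner u v : complex.Re `|inner u v| <= rnorm u * rnorm v.
Proof.
have [c c1 ->] := norm_inner_phase u v.
by apply: le_trans (ler_norm _) _; rewrite (le_trans (ler_rip _ _))// rnormZ c1 mul1r.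
Qed.

Lemma rip_le_norm_inner u v : rip u v <= complex.Re `|inner u v|.
Proof.
rewrite normc_def /rip; case: (inner u v) => x y /=.
by rewrite (le_trans (ler_norm _))// -sqrtr_sqr ler_wsqrtr// lerDl sqr_ge0.
Qed.

Lemma rip_phase T (c : R[i]) v : linear T -> complex.Re `|c| = 1 ->
  rip (T (c *: v)) (c *: v) = rip (T v) v.
Proof.
move=> lT c1; rewrite /rip (linear_atZ lT) innerZl innerZr mulrA -sqr_normc.
by rewrite -[`|c|]RRe_real ?normr_real// c1 expr1n mul1r.
Qed.

Lemma pos_op_adjoint_comp (A : H -> H) : linear A -> rbounded A ->
  pos_op (adjoint A \o A).
Proof.
move=> lA bA; have [M M0 AM] := bA; have [N N0 A'N] := adjoint_bounded lA bA.
split.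
- by move=> a u v /=; rewrite lA (adjoint_linear lA bA).
- by move=> u v /=; rewrite ripC -!adjoint_rip// ripC.
- by move=> v /=; rewrite ripC -adjoint_rip// ripE sqr_ge0.
- exists (N * M) => [|v /=]; first exact: mulr_ge0.
  by rewrite (le_trans (A'N _))// -mulrA ler_wpM2l.
Qed.

Lemma op_abs_pos (A : H -> H) : linear A -> rbounded A -> pos_op (op_abs A).
Proof.
by move=> lA bA; apply: op_pow_pos (or_introl _) => //; exact: pos_op_adjoint_comp.
Qed.

Lemma op_abs_sqr (A : H -> H) v : linear A -> rbounded A ->
  op_abs A (op_abs A v) = adjoint A (A v).
Proof.
by move=> lA bA; rewrite /op_abs op_pow_half_sqr//; exact: pos_op_adjoint_comp.
Qed.

(* [A^* P(A A^* ) = P(A^* A) A^*] for every polynomial [P]; let [P] tend to the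
   square root on an interval that contains both spectra. *)
Lemma op_abs_intertwine (A : H -> H) v : linear A -> rbounded A ->
  op_abs A (adjoint A v) = adjoint A (op_abs (adjoint A) v).
Proof.
move=> lA bA; have lA' := adjoint_linear lA bA; have bA' := adjoint_bounded lA bA.
have p1 := pos_op_adjoint_comp lA bA; have p2 := pos_op_adjoint_comp lA' bA'.
have [M1 M10 h1] := pos_op_bound p1; have [M2 M20 h2] := pos_op_bound p2.
pose M := M1 + M2; have M0 : 0 < M by exact: addr_gt0.
have [Q_ Qf] := @powR_approx R 2^-1 M M0 (or_introl (erefl _)).
have h1' w : rnorm ((adjoint A \o A) w) <= M * rnorm w.
  by rewrite (le_trans (h1 w))// ler_wpM2r ?rnorm_ge0// lerDl ltW.
have h2' w : rnorm ((adjoint (adjoint A) \o adjoint A) w) <= M * rnorm w.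
  by rewrite (le_trans (h2 w))// ler_wpM2r ?rnorm_ge0// lerDr ltW.
have c1 := cfc_cvg p1 M0 h1' Qf; have c2 := cfc_cvg p2 M0 h2' Qf.
apply: rip_inj => w; apply/eqP; rewrite -subr_eq0 -normr_le0.
apply: (@le_of_small_error _ _ _ 2) => // e /andP[e0 _].
have [N1 g1] := rop_cvg_rip (adjoint A v) w c1 e0.
have [N2 g2] := rop_cvg_rip v (A w) c2 e0.
have := g1 _ (leq_maxl N1 N2); have := g2 _ (leq_maxr N1 N2).
rewrite -(@op_horner_intertwine _ _ _ (adjoint A) _
    (adjoint (adjoint A) \o adjoint A) v lA');
  [|by case: p1|by case: p2|by move=> x /=; rewrite adjointK].
rewrite [rip (adjoint A _) w]ripC -adjoint_rip// [rip w (adjoint A _)]ripC.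
rewrite [rip (adjoint A _) w]ripC -adjoint_rip//.
rewrite [rip (A w) (op_horner _ _ _)]ripC [rip (A w) _]ripC (ripC w).
rewrite -/(op_pow _ _) -/(op_abs A) -/(op_pow _ _) -/(op_abs (adjoint A)).
rewrite !ler_norml; lra.
Qed.

(** With [y = (C + e) z] and [D = B + e], intertwining gives [D (A^* z) = A^* y], so
    [<A x, y> = <D x, A^* z>], and Cauchy-Schwarz applies to the form of [D]. *)
Lemma kato_rip (A : H -> H) x y : linear A -> rbounded A ->
  rip (A x) y ^+ 2 <= rip (op_abs A x) x * rip (op_abs (adjoint A) y) y.
Proof.
move=> lA bA; have lA' := adjoint_linear lA bA; have bA' := adjoint_bounded lA bA.
set B := op_abs A; set C := op_abs (adjoint A).
have [lB sB pB bB] : pos_op B := op_abs_pos lA bA.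
have [lC sC pC [K K0 CK]] : pos_op C := op_abs_pos lA' bA'.
have n0 : 0 <= rnorm x ^+ 2 := sqr_ge0 _.
apply: (@le_of_small_error _ _ _ (rnorm x ^+ 2 * rip (C y) y)); first exact: mulr_ge0.
move=> e /andP[e0 _].
have [z Ez] : exists z, C z + e%:C *: z = y.
  apply: (@coercive_surj _ _ (fun z => C z + e%:C *: z) e) => //.
  - move=> a u v; rewrite lC !scalerDr !scalerA (mulrC e%:C) addrACA//.
  - by move=> u v; rewrite !rip_linE sC.
  - exists (K + e); first by rewrite addr_ge0 ?(ltW e0).
    move=> v; rewrite (le_trans (ler_rnormD _ _))// mulrDl lerD//.
    by rewrite rnormZr gtr0_norm.
  - by move=> v; rewrite !rip_linE ripE lerDr.
pose D u := B u + e%:C *: u.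
have lD : linear D.
  by move=> a u v; rewrite /D lB !scalerDr !scalerA (mulrC e%:C) addrACA.
have sD : rsym D by move=> u v; rewrite /D !rip_linE sB.
have pD : rpos D.
  by move=> v; rewrite /D !rip_linE ripE addr_ge0// mulr_ge0 ?(ltW e0) ?sqr_ge0.
have Dw : D (adjoint A z) = adjoint A y.
  by rewrite /D /B op_abs_intertwine// -(linear_atZ lA') -(linear_atD lA') -/C Ez.
have -> : rip (A x) y = rip (D x) (adjoint A z) by rewrite sD Dw adjoint_rip.
apply: (le_trans (rsym_CauchySchwarz _ _ lD sD pD)).
have Dx : rip (D x) x = rip (B x) x + e * rnorm x ^+ 2 by rewrite /D !rip_linE ripE.
(* The left side is [<A A^* z, y> = <C C z, y>], and [C y = C C z + e C z] with [<C z, y> >= 0]. *)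
have : rip (D (adjoint A z)) (adjoint A z) <= rip (C y) y.
  have CCz : A (adjoint A z) = C (C z) by rewrite /C op_abs_sqr// adjointK.
  have Cy : C y = C (C z) + e%:C *: C z by rewrite -Ez (linear_atD lC) (linear_atZ lC).
  have Czy : 0 <= rip (C z) y.
    by rewrite -Ez !rip_linE ripE addr_ge0 ?sqr_ge0// mulr_ge0 ?(ltW e0).
  by rewrite Dw ripC -adjoint_rip// CCz Cy !rip_linE lerDl mulr_ge0// ltW.
rewrite Dx => h; apply: le_trans (ler_wpM2l _ h) _.
  by rewrite addr_ge0// mulr_ge0// ltW.
by lra.
Qed.

(** The phase is put on the first vector, where [rip_phase] shows that the form of |A| does not see
    it. *)
Lemma kato (A : H -> H) v : linear A -> rbounded A ->
  complex.Re `|inner (A v) v| ^+ 2 <=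
    rip (op_abs A v) v * rip (op_abs (adjoint A) v) v.
Proof.
move=> lA bA; have [c c1 ->] := norm_inner_phase (A v) v.
have [lB _ _ _] := op_abs_pos lA bA.
by rewrite -(linear_atZ lA) (le_trans (kato_rip _ _ lA bA))// rip_phase.
Qed.

End Kato.

(** * Scalar inequalities: Young with a quadratic remainder *)

Section Young.
Context {R : realType}.

(* Subtracting the square leaves a combination of [a * b] and [b ^ 2], to which
   Young's inequality with exponents [p / 2] and [p / (p - 2)] applies. *)
Lemma young_square_le (p q a b : R) : 0 < q -> q <= p -> p^-1 + q^-1 = 1 ->
  0 <= a -> 0 <= b ->
  a `^ (2 / p) * b `^ (2 / q) <= a ^+ 2 / p + b ^+ 2 / q - p^-1 * (a - b) ^+ 2.
Proof.
move=> q0 qp pq a0 b0; have p0 : 0 < p := lt_le_trans q0 qp.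
have ab0 := mulr_ge0 a0 b0.
have Eq : q^-1 = 1 - p^-1 by lra.
have pq' : p^-1 <= q^-1 by rewrite lef_pV2.
have -> : a ^+ 2 / p + b ^+ 2 / q - p^-1 * (a - b) ^+ 2 =
    2 / p * (a * b) + (1 - 2 / p) * b ^+ 2 by rewrite Eq; ring.
have -> : 2 / q = 2 / p + 2 * (1 - 2 / p) by rewrite Eq; ring.
set c := 1 - 2 / p.
have : 0 <= c by rewrite /c; lra.
rewrite le_eqVlt => /predU1P[c0|c0].
  (* Here [p = 2]: the exponent [c^-1] would be infinite, and both sides equal [a * b]. *)
  have p2 : 2 / p = 1 by move: c0; rewrite /c; lra.
  by rewrite -c0 mulr0 addr0 mul0r addr0 p2 !powRr1// mul1r.
rewrite powRD; last by apply/implyP => /eqP; have := divr_gt0 (ltr0Sn R 1) p0; lra.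
rewrite mulrA -powRM//.
have := @conjugate_powR R ((a * b) `^ (2 / p)) (b `^ (2 * c)) (p / 2) c^-1
  (powR_ge0 _ _) (powR_ge0 _ _).
rewrite divr_gt0// invr_gt0 => /(_ isT c0); rewrite -!powRrM invrK.
have -> : 2 / p * (p / 2) = 1 by field; rewrite gt_eqF.
have -> : 2 * c / c = 2 by rewrite mulfK// gt_eqF.
have -> : (p / 2)^-1 = 2 / p by field; rewrite gt_eqF.
rewrite powRr1// powR_mulrn// => h; apply: le_trans (h _) _; last by lra.
by rewrite /c; lra.
Qed.

Lemma young_square (p q a b : R) : 0 < p -> 0 < q -> p^-1 + q^-1 = 1 ->
  0 <= a -> 0 <= b ->
  a `^ (2 / p) * b `^ (2 / q) <=
    a ^+ 2 / p + b ^+ 2 / q - Num.min p^-1 q^-1 * (a - b) ^+ 2.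
Proof.
move=> p0 q0 pq a0 b0; have [qp|/ltW qp] := leP q p.
  by rewrite min_l ?lef_pV2//; exact: young_square_le.
rewrite min_r ?lef_pV2// mulrC (addrC (a ^+ 2 / p)) -(sqrrN (a - b)) opprB.
by apply: young_square_le => //; rewrite addrC.
Qed.

(** Take [a = x ^ (p r / 4)] and [b = y ^ (q r / 4)] in [young_square]: the left side becomes
    [(x y) ^ (r / 2)], which dominates [(z^2) ^ (r / 2) = z ^ r]. *)
Lemma young_square_powR (p q r x y z : R) : 0 < p -> 0 < q -> p^-1 + q^-1 = 1 ->
  0 < r -> 0 <= x -> 0 <= y -> 0 <= z -> z ^+ 2 <= x * y ->
  z `^ r <= x `^ (p * r / 2) / p + y `^ (q * r / 2) / q
    - Num.min p^-1 q^-1 * (x `^ (p * r / 4) - y `^ (q * r / 4)) ^+ 2.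
Proof.
move=> p0 q0 pq r0 x0 y0 z0 zxy.
have -> : z `^ r = (z ^+ 2) `^ (r / 2).
  by rewrite -powR_mulrn// -powRrM; congr (_ `^ _); field.
have E1 a s : 0 < s -> (a `^ (s * r / 4)) `^ (2 / s) = a `^ (r / 2).
  by move=> s0; rewrite -powRrM; congr (_ `^ _); field; rewrite gt_eqF.
have E2 a s : (a `^ (s * r / 4)) ^+ 2 = a `^ (s * r / 2).
  by rewrite -powR_mulrn ?powR_ge0// -powRrM; congr (_ `^ _); field.
have := young_square p0 q0 pq (powR_ge0 x (p * r / 4)) (powR_ge0 y (q * r / 4)).
rewrite !E1// !E2; apply: le_trans; rewrite -powRM//.
apply: ge0_ler_powR; rewrite ?nnegrE ?sqr_ge0//; first by rewrite divr_ge0 ?(ltW r0).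
exact: mulr_ge0.
Qed.

(** Rewriting the bound as [z <= c ^ (1 / r)] also shows that [E] is bounded above, so that [sup E]
    is a true supremum. *)
Lemma sup_powR_le (E : set R) (r c : R) : 0 < r -> E !=set0 ->
  (forall z, E z -> 0 <= z /\ z `^ r <= c) -> sup E `^ r <= c.
Proof.
move=> r0 [z Ez] Ec; have r0' : 0 <= r := ltW r0.
have c0 : 0 <= c by case: (Ec z Ez) => _; apply: le_trans; exact: powR_ge0.
have ubE : ubound E (c `^ r^-1).
  move=> y /Ec[y0 yc]; rewrite -[y]powRr1// -(mulfV (lt0r_neq0 r0)) powRrM.
  by rewrite ge0_ler_powR ?nnegrE ?powR_ge0 ?invr_ge0.
rewrite -[c]powRr1// -(mulVf (lt0r_neq0 r0)) powRrM.
apply: ge0_ler_powR; rewrite ?nnegrE ?powR_ge0//.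
  by apply: le_trans (Ec z Ez).1 _; apply: ub_le_sup => //; exists (c `^ r^-1).
by apply: ge_sup => //; exists z.
Qed.

End Young.

(** * Berezin norm and conclusion *)

Section Berezin.
Context {R : realType} {X : Type} {H : rkhsType R X}.

Lemma rnorm_nkernel (x : X) : rkernel x != 0 :> H -> rnorm (nkernel x : H) = 1.
Proof.
move=> k0; rewrite /nkernel rnormZ normrV ?unitfE ?normr_eq0// normr_id.
rewrite rnormE -fmorphV /= mulVf//; apply/eqP => /rnorm_eq0/eqP.
by rewrite (negbTE k0).
Qed.

(** Diagonal pairs take part in the supremum, which is a true one because [T] is bounded and the
    kernels have norm 1. *)
Lemma rip_le_ber_norm (T : H -> H) (x : X) :
  (forall x : X, rkernel x != 0 :> H) -> rbounded T ->
  rip (T (nkernel x)) (nkernel x) <= ber_norm T.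
Proof.
move=> k0 [M M0 TM]; apply: le_trans (rip_le_norm_inner _ _) _.
apply: ub_le_sup; last by exists (x, x).
exists M => _ [[y z] _ <-] /=; apply: le_trans (ler_norm_inner _ _) _.
by rewrite rnorm_nkernel// mulr1 (le_trans (TM _))// rnorm_nkernel// mulr1.
Qed.

End Berezin.

Theorem theorem4p4 (R : realType) (X : Type) (H : rkhsType R X)
    (X_nonempty : inhabited X)
    (kernel_neq0 : forall x : X, rkernel x != 0 :> H)
    (A : {linear H -> H}) (A_bounded : continuous A)
    (p q : R) (p_ge1 : 1 <= p) (q_ge1 : 1 <= q) (pq1 : 1 / p + 1 / q = 1)
    (r : R) (r_ge2 : 2 <= r) :
  ber A `^ r <=
    ber_norm ((1 / p)%:C *: op_pow (op_abs A) (p * r / 2)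
              + (1 / q)%:C *: op_pow (op_abs (adjoint A)) (q * r / 2))
    - Num.min (1 / p) (1 / q) *
      inf (range (fun x : X =>
        (complex.Re (inner (op_abs A (nkernel x)) (nkernel x)) `^ (p * r / 4)
         - complex.Re (inner (op_abs (adjoint A) (nkernel x)) (nkernel x))
             `^ (q * r / 4)) ^+ 2)).
Proof.
have bA : rbounded A := continuous_rbounded A_bounded.
have lA : linear A := linearP A.
have pB := op_abs_pos lA bA.
have pC := op_abs_pos (adjoint_linear lA bA) (adjoint_bounded lA bA).
have p0 : 0 < p by lra.
have q0 : 0 < q by lra.
have r0 : 0 < r by lra.
(* [r >= 2] places both exponents in the range of [op_pow_pos] and [mccarthy]. *)
have ps : 1 <= p * r / 2.
  by rewrite ler_pdivlMr// mul1r (le_trans r_ge2)// ler_peMl//; lra.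
have qs : 1 <= q * r / 2.
  by rewrite ler_pdivlMr// mul1r (le_trans r_ge2)// ler_peMl//; lra.
rewrite !div1r in pq1 *.
set V := (X in ber_norm X); set m := Num.min _ _; set G := (X in m * X).
have m0 : 0 <= m by rewrite le_min !invr_ge0 !ltW.
have bV : rbounded V.
  have [_ _ _ bB] := op_pow_pos pB (or_intror ps).
  have [_ _ _ bC] := op_pow_pos pC (or_intror qs).
  exact: rbounded_lincomb.
have key x : complex.Re `|inner (A (nkernel x)) (nkernel x)| `^ r <= ber_norm V - m * G.
  set k := nkernel x; have k1 : rnorm k = 1 by exact: rnorm_nkernel.
  set b := rip (op_abs A k) k; set c := rip (op_abs (adjoint A) k) k.
  have b0 : 0 <= b by have [_ _ h _] := pB; exact: h.
  have c0 : 0 <= c by have [_ _ h _] := pC; exact: h.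
  set z := complex.Re _.
  have z0 : 0 <= z by rewrite -ler0c RRe_real ?normr_real.
  have zbc : z ^+ 2 <= b * c := kato k lA bA.
  have young := young_square_powR p0 q0 pq1 r0 b0 c0 z0 zbc.
  have Bk : b `^ (p * r / 2) / p <= p^-1 * rip (op_pow (op_abs A) (p * r / 2) k) k.
    by rewrite mulrC ler_wpM2l ?invr_ge0 ?(ltW p0)//; exact: mccarthy.
  have Ck : c `^ (q * r / 2) / q <=
      q^-1 * rip (op_pow (op_abs (adjoint A)) (q * r / 2) k) k.
    by rewrite mulrC ler_wpM2l ?invr_ge0 ?(ltW q0)//; exact: mccarthy.
  have Vk := rip_le_ber_norm x kernel_neq0 bV; rewrite -/k in Vk.
  have VE : rip (V k) k = p^-1 * rip (op_pow (op_abs A) (p * r / 2) k) k +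
      q^-1 * rip (op_pow (op_abs (adjoint A)) (q * r / 2) k) k.
    exact: rip_lincomb.
  (* Squares are bounded below by 0, so [G] is a true infimum and lies below its value at [x]. *)
  have Gk : m * G <= m * (b `^ (p * r / 4) - c `^ (q * r / 4)) ^+ 2.
    apply: ler_wpM2l => //; apply: ge_inf; last by exists x.
    by exists 0 => _ [y _ <-]; exact: sqr_ge0.
  apply: le_trans young _; apply: le_trans (lerB (lerD Bk Ck) Gk) _.
  by rewrite lerD2r -VE; exact: Vk.
have [x0] := X_nonempty; apply: sup_powR_le => //.
  by exists (complex.Re `|inner (A (nkernel x0)) (nkernel x0)|), x0.
move=> _ [x _ <-]; split; last exact: key.
by rewrite -ler0c RRe_real ?normr_real.
Qed.
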